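(* Let $d\ge 1$ be an integer, let $V\in C_b^\infty(\mathbb{R}^d;\mathbb{R})$ and let $E\in\mathbb{R}$ be such that $\mathcal{G}_E=\{x\in\mathbb{R}^d \mid V(x)\le E\}$ is nonempty and $\inf_{x\in \mathbb{R}^d\setminus\mathcal{G}_{E,\delta}}V(x)>E$ for every $\delta>0$. Then for any $C_0>0$, $\delta_0>0$ and $0<\varepsilon<1$, there exist $C>0$, $h_0>0$, $0<\delta<\delta_0$, functions $\chi,\tilde\chi\in C_b^\infty(\mathbb{R}^d;[0,1])$ with $$\operatorname{supp}(1-\chi)\subset\mathcal{G}_{E,\delta},\qquad \operatorname{supp}\tilde\chi\subset\mathcal{G}_{E,\delta}\setminus\mathcal{G}_{E,\delta/2},$$ and a function $\rho\in C^\infty(\mathbb{R}^d;\mathbb{R}_{\ge 0})$ with $$|\rho(x)-(1-\varepsilon)d_E(x)|\le\varepsilon\quad\text{for all }x\in\mathbb{R}^d,$$ such that for every $0<h<h_0$, $$\|\chi e^{\rho(x)/h}u\|_{\ell^2}\le C\|\tilde\chi u\|_{\ell^2}+C\|\chi e^{\rho(x)/h}(H(h)-z)u\|_{\ell^2}$$ for any $u\in\ell^2(h\mathbb{Z}^d)$ and any $z\in[E-C_0,E+C_0h]+i[-C_0,C_0]$.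
   Context: $C_b^\infty(\mathbb{R}^d)$ is the space of smooth functions that are bounded together with all their derivatives. For $\delta>0$, $\mathcal{G}_{E,\delta}=\{x\in\mathbb{R}^d\mid \mathrm{dist}(x,\mathcal{G}_E)<\delta\}$ (Euclidean distance). For $h>0$, $H(h)$ is the semiclassical discrete Schrödinger operator on $\ell^2(h\mathbb{Z}^d)$ (complex-valued functions, $\|u\|_{\ell^2}^2=\sum_{x\in h\mathbb{Z}^d}|u(x)|^2$) defined by $$H(h)u(x)=-\sum_{y\in h\mathbb{Z}^d,\ |x-y|=h}(u(y)-u(x))+V(x)u(x),\qquad x\in h\mathbb{Z}^d\subset\mathbb{R}^d .$$ Functions on $\mathbb{R}^d$ act on functions on $h\mathbb{Z}^d$ by multiplication by their restriction. Weighted $\ell^2$ norms may take the value $+\infty$. With $(t)_+=\max\{t,0\}$, define for $x\in\mathbb{R}^d$ $$K_x=\Bigl\{\xi\in\mathbb{R}^d \Bigm| \sum_{j=1}^d\sinh^2\tfrac{\xi_j}{2}\le\tfrac{(V(x)-E)_+}{4}\Bigr\},\qquad L(x,v)=\sup_{\xi\in K_x}\langle\xi,v\rangle\quad(v\in\mathbb{R}^d)$$ (the Agmon-Finsler metric), and $$d_E(x,y)=\inf_{x(\cdot)}\int_0^1L(x(t),x'(t))\,dt,$$ where the infimum is over $C^1$ curves $x(\cdot):[0,1]\to\mathbb{R}^d$ with $x(0)=x$, $x(1)=y$. Finally $d_E(x)=\inf_{y\in\mathcal{G}_E}d_E(x,y)$. *)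

(* Defs.v *)
From mathcomp Require Import all_boot all_order all_algebra.
From mathcomp Require Import all_classical all_reals all_analysis.
From mathcomp Require Import complex.

Set Implicit Arguments.
Unset Strict Implicit.
Unset Printing Implicit Defensive.

Import Order.TTheory GRing.Theory Num.Theory.
Import numFieldNormedType.Exports.

Local Open Scope classical_set_scope.
Local Open Scope ring_scope.
Local Open Scope complex_scope.

Section Euclidean.
Context {R : realType} {d : nat}.
Implicit Types (x y v : 'rV[R]_d) (A : set 'rV[R]_d) (f : 'rV[R]_d -> R).

Definition eucl_dot x y : R := \sum_(j < d) x 0 j * y 0 j.

(* The norm that the library puts on 'rV[R]_d is the sup norm, so the Euclidean
   norm is introduced separately; both induce the same topology. *)
Definition eucl_norm x : R := Num.sqrt (eucl_dot x x).

(* Meaningful for nonempty [A] only. *)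
Definition eucl_dist x A : R := inf [set eucl_norm (x - y) | y in A].

Definition tsupport f : set 'rV[R]_d := closure [set x | f x != 0].

(* [pderivs [:: i_1; ...; i_k] f] is d_(i_1) ... d_(i_k) f. *)
Fixpoint pderivs (s : seq 'I_d) f : 'rV[R]_d -> R :=
  if s is i :: s' then 'D_(delta_mx 0 i) (pderivs s' f) else f.

(* 'D_v takes a junk value where the directional derivative does not exist,
   hence the explicit derivability requirement. *)
Definition smooth f : Prop :=
  forall s : seq 'I_d,
    continuous (pderivs s f) /\
    forall (i : 'I_d) x, derivable (pderivs s f) x (delta_mx 0 i).

Definition smooth_bounded f : Prop :=
  smooth f /\
  forall s : seq 'I_d, exists M : R, forall x, `|pderivs s f x| <= M.

End Euclidean.

Section Agmon.
Context {R : realType} {d : nat}.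
Variables (V : 'rV[R]_d -> R) (E : R).
Implicit Types (x y v xi : 'rV[R]_d).

Definition sinh (t : R) : R := (expR t - expR (- t)) / 2.

Definition classical_region : set 'rV[R]_d := [set x | V x <= E].

Definition classical_nbhd (delta : R) : set 'rV[R]_d :=
  [set x | eucl_dist x classical_region < delta].

Definition agmon_body x : set 'rV[R]_d :=
  [set xi : 'rV[R]_d |
     \sum_(j < d) sinh (xi 0 j / 2) ^+ 2 <= Num.max (V x - E) 0 / 4].

(* [agmon_body x] is compact and contains 0, so this supremum is a genuine
   nonnegative real. *)
Definition agmon_finsler x v : R :=
  sup [set eucl_dot xi v | xi in agmon_body x].

(* C^1 curves [0,1] -> R^d together with their derivative: difference quotients
   and continuity are relative to [0,1] (one-sided at the endpoints), and the
   values of [c] and [c'] outside [0,1] are irrelevant. *)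
Definition C1_curve (c c' : R -> 'rV[R]_d) : Prop :=
  (forall t : R, t \in `[0, 1] ->
     (s - t)^-1 *: (c s - c t) @[s --> within [set` `[0, 1]] t^'] --> c' t) /\
  {within `[0, 1], continuous c'}.

Definition agmon_length (c c' : R -> 'rV[R]_d) : R :=
  \int[lebesgue_measure]_(t in `[0, 1]) agmon_finsler (c t) (c' t).

Definition agmon_dist x y : R :=
  inf [set l | exists c c' : R -> 'rV[R]_d,
         [/\ C1_curve c c', c 0 = x, c 1 = y & l = agmon_length c c']].

Definition agmon_dist_region x : R :=
  inf [set agmon_dist x y | y in classical_region].

End Agmon.

Definition lattice {R : realType} (d : nat) (h : R) : set 'rV[R]_d :=
  [set h *: map_mx intr n | n in [set: 'rV[int]_d]].
Arguments lattice {R} d h.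

Section Lattice.
Context {R : realType} {d : nat} {h : R}.
Implicit Types u : lattice d h -> R[i].

Definition l2norm u : \bar R :=
  sqrte (\esum_(x in [set: lattice d h]) (Normc.normc (u x) ^+ 2)%:E).

Definition ell2 u : Prop := (l2norm u < +oo)%E.

Definition fmul (f : 'rV[R]_d -> R) u : lattice d h -> R[i] :=
  fun x => (f (\val x))%:C * u x.

(* The index set of the sum is finite when [h != 0]. *)
Definition schrodinger (V : 'rV[R]_d -> R) u : lattice d h -> R[i] :=
  fun x =>
    - (\sum_(y \in [set y : lattice d h | eucl_norm (\val x - \val y) = h])
         (u y - u x)) + (V (\val x))%:C * u x.

End Lattice.

(* Main.v *)
Require Import Defs.
From mathcomp Require Import all_boot all_order all_algebra.
From mathcomp Require Import all_classical all_reals all_analysis.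
From mathcomp Require Import complex.
From mathcomp Require Import ring lra zify.

(** The weight [rho] is a smooth version of [(1 - eps) d_E], lowered by [eps / 2]
    so that it vanishes near the classically allowed region, where the error
    terms of the cutoff [chi] live.  Deforming a curve near its origin shows that
    [d_E (x + v) <= d_E x + sup L(., v)] with the supremum over a small ball; this
    one-sided estimate is invariant under averaging over translations, so it
    survives convolution with a bump function and says that the gradient of [rho]
    at [x] pairs with every [v] to at most [(1 - eps)] times the support function
    of a slight enlargement of [K_x].  By convexity of
    [F(xi) = sum sinh^2(xi_j / 2)], testing with the gradient of [F] gives
    [F(grad rho) <= (1 - eps) (V - E)_+ / 4 + small], hence a spectral gap for the
    conjugated operator away from the allowed region.

    On the lattice, with [w = chi e^(rho/h) u], the hopping terms are bounded by
    [g |w(x)| |w(y)| <= g (|w(x)|^2 + |w(y)|^2) / 2], where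
    [g = e^((rho(x) - rho(y)) / h)]; summation over [x] symmetrises [g] into
    [cosh((rho(x) - rho(y)) / h)], which the gap absorbs.  To have finite sums,
    [rho] is first replaced by [min rho k], which does not increase the cosh. *)

Import Order.TTheory GRing.Theory Num.Theory.
Import numFieldNormedType.Exports.

Local Open Scope classical_set_scope.
Local Open Scope ring_scope.

(** * Directional derivatives and Lipschitz functions *)

(** The Agmon distance is only Lipschitz, and the metric only Hölder of exponent 1/2 in [x], since
    [K_x] opens like the square root of [(V - E)_+]. The proof therefore uses no pointwise eikonal
    inequality for the distance, only one-sided inequalities between nearby points; these survive
    averaging, and the smooth average can then be differentiated. Convolution is carried out as
    successive averages along the coordinate axes, so every integral is one-dimensional, and
    derivatives of averages are read off from quadratic remainders. Lipschitz constants refer to the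
    sup norm; the Euclidean norm enters through the distance to the allowed region and the neighbour
    relation. The gap comes from the factor [1 - eps]: where [V >= E + c1] it leaves
    [eps * (V - E) >= eps * c1]. Half of [eps * c1] pays for comparing the metric at nearby points,
    a quarter for all terms of order [h], and the last quarter is the gap. The Taylor constant of
    [rho] is uniform in space and is fixed before [h0], which makes the estimate uniform in [h]. *)

Section LineCalculus.
Context {R : realType}.

(** Derivatives of averages are established in this form: a quadratic remainder bound can be
    integrated directly, whereas a limit would have to be interchanged with the integral. *)
Lemma is_derive_of_sqr_remainder {U : normedModType R} (f : U -> R) (x v : U) (p M r : R) :
  0 < r ->
  (forall t, `|t| <= r -> `|f (x + t *: v) - f x - t * p| <= M * t ^+ 2) ->
  is_derive x v f p.
Proof.
move=> r0 fM.
have cv : h^-1 *: ((f \o shift x) (h *: v) - f x) @[h --> 0^'] --> p.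
  apply/cvgrPdist_le => e e0.
  have M1 : 0 < `|M| + 1 by rewrite ltr_wpDl.
  near=> h.
  have h0 : h != 0 by near: h; exact: nbhs_dnbhs_neq.
  have hr : `|h| <= Num.min r (e / (`|M| + 1)).
    near: h; apply: dnbhs0_le; rewrite lt_min r0 /=; exact: divr_gt0.
  move: hr; rewrite le_min => /andP[hr he].
  rewrite /= [h *: v + x]addrC.
  have -> : p - h^-1 *: (f (x + h *: v) - f x) =
     - (h^-1 * (f (x + h *: v) - f x - h * p)).
    by rewrite /GRing.scale/=; field.
  rewrite normrN normrM normfV ler_pdivrMl ?normr_gt0//.
  apply: le_trans (fM _ hr) _.
  rewrite -(@real_normK _ h) ?num_real// expr2 [`|h| * e]mulrC mulrA.
  apply: ler_wpM2r => //.
  apply: le_trans (_ : `|M| * `|h| <= _); first by rewrite ler_wpM2r// ler_norm.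
  apply: le_trans (_ : (`|M| + 1) * `|h| <= _); first by rewrite ler_wpM2r// lerDl.
  by rewrite mulrC -ler_pdivlMr.
split; first by apply/cvg_ex; exists p.
exact: cvg_lim cv.
Unshelve. all: by end_near. Qed.

Lemma is_derive_line {U : normedModType R} (f : U -> R) (x v : U) (t p : R) :
  is_derive (x + t *: v) v f p -> is_derive t 1 (fun s => f (x + s *: v)) p.
Proof.
case=> fd fp.
have E : (fun h : R =>
      h^-1 *: (((fun s => f (x + s *: v)) \o shift t) (h *: (1 : R)) - f (x + t *: v)))
   = (fun h : R => h^-1 *: ((f \o shift (x + t *: v)) (h *: v) - f (x + t *: v))).
  apply/funext => h /=; congr (_ *: (f _ - _)).
  by rewrite [h *: 1]mulr1 scalerDl addrCA.
by split; [rewrite /derivable/= E|rewrite -fp /derive/= E].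
Qed.

Lemma MVT_line {U : normedModType R} (f df : U -> R) (x v : U) (t : R) :
  (forall s, `|s| <= `|t| -> is_derive (x + s *: v) v f (df (x + s *: v))) ->
  exists s, `|s| <= `|t| /\ f (x + t *: v) - f x = t * df (x + s *: v).
Proof.
move=> fd.
have d1 (s : R) : `|s| <= `|t| ->
    is_derive s 1 (fun s => f (x + s *: v)) (df (x + s *: v)).
  by move=> st; apply: is_derive_line; exact: fd.
have [t0|t0] := leP 0 t.
  have st (s : R) : 0 <= s <= t -> `|s| <= `|t|.
    by move=> /andP[s0 st]; rewrite !ger0_norm.
  have d2 (s : R) : s \in `]0, t[ ->
      is_derive s 1 (fun s => f (x + s *: v)) (df (x + s *: v)).
    by rewrite in_itv/= => /andP[s0 s1]; apply: d1; apply: st; rewrite !ltW.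
  have c : {within `[0, t], continuous (fun s => f (x + s *: v))}.
    apply: derivable_within_continuous => s; rewrite in_itv/= => /st /d1.
    by case.
  have [s /=] := MVT_segment t0 d2 c.
  rewrite in_itv/= => s0; rewrite scale0r addr0 subr0 => E.
  by exists s; rewrite E mulrC st.
have st (s : R) : t <= s <= 0 -> `|s| <= `|t|.
  by move=> /andP[ts s0]; rewrite !ler0_norm ?lerN2// ltW.
have d2 (s : R) : s \in `]t, 0[ ->
    is_derive s 1 (fun s => f (x + s *: v)) (df (x + s *: v)).
  by rewrite in_itv/= => /andP[s0 s1]; apply: d1; apply: st; rewrite !ltW.
have c : {within `[t, 0], continuous (fun s => f (x + s *: v))}.
  apply: derivable_within_continuous => s; rewrite in_itv/= => /st /d1.
  by case.
have [s /=] := MVT_segment (ltW t0) d2 c.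
rewrite in_itv/= => s0; rewrite scale0r addr0 sub0r => E.
exists s; split; first exact: st.
by rewrite -opprB E mulrN opprK mulrC.
Qed.

Definition lip {U : normedModType R} (L : R) (f : U -> R) :=
  forall x y, `|f x - f y| <= L * `|x - y|.

Lemma lip_ge {U : normedModType R} (L M : R) (f : U -> R) : L <= M -> lip L f -> lip M f.
Proof. by move=> LM fL x y; apply: le_trans (fL x y) _; rewrite ler_wpM2r. Qed.

Lemma lip_continuous {U : normedModType R} (L : R) (f : U -> R) : lip L f -> continuous f.
Proof.
move=> fL x; apply/cvgrPdist_le => e e0.
have L1 : 0 < `|L| + 1 by rewrite ltr_wpDl.
near=> y; apply: le_trans (fL x y) _.
apply: le_trans (_ : (`|L| + 1) * `|x - y| <= _).
  by rewrite ler_wpM2r// (le_trans (ler_norm L)) ?lerDl.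
rewrite mulrC -ler_pdivlMr//.
near: y; apply: cvgr_dist_le; [exact: cvg_id|exact: divr_gt0].
Unshelve. all: by end_near. Qed.

Lemma lip_line {U : normedModType R} (L : R) (f : U -> R) (x v : U) :
  lip L f -> lip (L * `|v|) (fun s : R => f (x + s *: v)).
Proof.
move=> fL s t; apply: le_trans (fL _ _) _.
by rewrite opprD addrACA subrr add0r -scalerBl normrZ mulrAC mulrA.
Qed.

Lemma derive_le_lip {U : normedModType R} (L : R) (f : U -> R) (x v : U) (p : R) :
  lip L f -> is_derive x v f p -> `|p| <= L * `|v|.
Proof.
move=> fL [fd fp].
have cv : h^-1 *: ((f \o shift x) (h *: v) - f x) @[h --> 0^'] --> p by rewrite -fp.
have /cvg_norm ncv := cv.
apply: (@ler_cvg_to _ _ _ _ _ _ _ _ ncv (cvg_cst (L * `|v|))).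
near=> h.
have h0 : h != 0 by near: h; exact: nbhs_dnbhs_neq.
rewrite normrM normfV ler_pdivrMl ?normr_gt0//=.
by apply: le_trans (fL _ _) _; rewrite addrK normrZ mulrCA.
Unshelve. all: by end_near. Qed.

Lemma sqr_remainder_line {U : normedModType R} (L : R) (f df : U -> R) (x v : U) (t : R) :
  (forall y, is_derive y v f (df y)) -> lip L df ->
  `|f (x + t *: v) - f x - t * df x| <= L * `|v| * t ^+ 2.
Proof.
move=> fd dfL; have [s [st ->]] := MVT_line f df x v t (fun s _ => fd _).
have L0 : 0 <= L * `|v|.
  have := dfL (x + v) x; rewrite [x + v]addrC addrK; exact: le_trans.
rewrite -mulrBr normrM -(@real_normK _ t) ?num_real// expr2 mulrCA.
rewrite ler_wpM2l// (le_trans (dfL _ _))// [x + _]addrC addrK normrZ.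
by rewrite mulrCA mulrC ler_wpM2l.
Qed.

End LineCalculus.

(** * Averages over [-1, 1] *)

Section UnitIntegral.
Context {R : realType}.
Implicit Types g h k : R -> R.

Definition unit_int g : R := \int[lebesgue_measure]_(t in `[(-1 : R), 1]) g t.

Let integrable_cont g : continuous g ->
  (@lebesgue_measure R).-integrable `[(-1 : R), 1] (EFin \o g).
Proof.
move=> cg; apply: continuous_compact_integrable; first exact: segment_compact.
exact: continuous_subspaceT.
Qed.

Lemma unit_intD g h : continuous g -> continuous h ->
  unit_int (fun t => g t + h t) = unit_int g + unit_int h.
Proof. by move=> cg ch; rewrite /unit_int RintegralD//; apply: integrable_cont. Qed.

Lemma unit_intB g h : continuous g -> continuous h ->
  unit_int (fun t => g t - h t) = unit_int g - unit_int h.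
Proof. by move=> cg ch; rewrite /unit_int RintegralB//; apply: integrable_cont. Qed.

Lemma unit_intZ c g : continuous g -> unit_int (fun t => c * g t) = c * unit_int g.
Proof. by move=> cg; rewrite /unit_int RintegralZl//; apply: integrable_cont. Qed.

Lemma le_unit_int g h : continuous g -> continuous h ->
  (forall t, -1 <= t <= 1 -> g t <= h t) -> unit_int g <= unit_int h.
Proof.
move=> cg ch gh; rewrite /unit_int; apply: le_Rintegral.
- by [].
- exact: integrable_cont.
- exact: integrable_cont.
- by move=> t /=; rewrite in_itv/=; exact: gh.
Qed.

Lemma normr_unit_int_le g h : continuous g -> continuous h ->
  (forall t, -1 <= t <= 1 -> `|g t| <= h t) -> `|unit_int g| <= unit_int h.
Proof.
move=> cg ch gh; apply: le_trans (le_normr_Rintegral _ _) _ => //.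
  exact: integrable_cont.
apply: le_unit_int => //.
by move=> t; apply: cvg_norm; exact: cg.
Qed.

Lemma normr_unit_intM g k B : continuous g -> continuous k ->
  (forall t, -1 <= t <= 1 -> `|g t| <= B) ->
  `|unit_int (fun t => g t * k t)| <= B * unit_int (fun t => `|k t|).
Proof.
move=> cg ck gB.
have cnk : continuous (fun t => `|k t|) by move=> t; apply: cvg_norm; exact: ck.
rewrite -unit_intZ//; apply: normr_unit_int_le.
- by move=> t; apply: cvgM; [exact: cg|exact: ck].
- by move=> t; apply: cvgM; [exact: cvg_cst|exact: cnk].
- by move=> t t1; rewrite normrM ler_wpM2r// gB.
Qed.

Lemma antiderivative g (B : R) : continuous g -> 0 < B ->
  exists G : R -> R, continuous G /\
    forall u : R, -B < u < B -> is_derive u 1 G (g u).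
Proof.
move=> cg B0.
pose G0 u := \int[lebesgue_measure]_(t in `[- (2 * B), u]) g t.
have G0d (u : R) : - (2 * B) < u < 2 * B -> is_derive u 1 G0 (g u).
  move=> /andP[Bu uB].
  have ig : (@lebesgue_measure R).-integrable `[- (2 * B), 2 * B] (EFin \o g).
    apply: continuous_compact_integrable; first exact: segment_compact.
    exact: continuous_subspaceT.
  have [dG GE] := continuous_FTC1_closed uB ig Bu (cg u).
  by apply: DeriveDef; [exact: dG|rewrite -derive1E; exact: GE].
(* [G0] is controlled only inside []-2B, 2B[]; composing it with the projection onto [[-B, B]] keeps
   its derivative inside and makes it continuous on the whole line. *)
pose cl (u : R) := Num.max (- B) (Num.min u B).
have ccl : continuous cl.
  apply: (@lip_continuous _ _ 1) => u v; rewrite mul1r /cl ler_norml.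
  have h1 := ler_norm (u - v); have h2 := ler_norm (v - u); rewrite distrC in h2.
  case: (leP u B) => ?; case: (leP v B) => ?;
    case: (leP (- B) u) => ?; case: (leP (- B) v) => ?;
    rewrite ?(max_r (_ : - B <= B)); try lra; apply/andP; split; lra.
exists (G0 \o cl); split=> [u|u /andP[Bu uB]].
  apply: continuous_comp; first exact: ccl.
  have clB : - (2 * B) < cl u < 2 * B.
    rewrite /cl; case: (leP u B) => ?; case: (leP (- B) u) => ?;
    rewrite ?(max_r (_ : - B <= B)); try lra; apply/andP; split; lra.
  by have [/derivable1_diffP /differentiable_continuous] := G0d _ clB.
have E : {near u, G0 =1 G0 \o cl}.
  near=> v => /=; congr G0; rewrite /cl.
  have vB : v <= B by near: v; exact: lt_le_nbhsl.
  have Bv : - B <= v by near: v; exact: lt_le_nbhsr.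
  by rewrite min_l ?max_r.
have dG0 : is_derive u 1 G0 (g u) by apply: G0d; lra.
apply: near_eq_is_derive E dG0.
Unshelve. all: by end_near. Qed.

(** The boundary terms vanish with [k]. [G] need only be a primitive near [[-1, 1]], which is what
    [antiderivative] provides. *)
Lemma unit_int_by_parts (k dk G g : R -> R) : continuous dk -> continuous g ->
  (forall t : R, is_derive t 1 k (dk t)) -> k (-1) = 0 -> k 1 = 0 ->
  (forall t : R, -2 < t < 2 -> is_derive t 1 G (g t)) ->
  unit_int (fun t => g t * k t) = - unit_int (fun t => G t * dk t).
Proof.
move=> cdk cg kd k1 k2 Gd.
have lt11 : (-1 : R) < 1 by lra.
have cder (f df : R -> R) (x : R) : is_derive x 1 f (df x) -> f y @[y --> x] --> f x.
  by move=> [/derivable1_diffP /differentiable_continuous].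
have der01 (f df : R -> R) : (forall t : R, -2 < t < 2 -> is_derive t 1 f (df t)) ->
    derivable_oo_LRcontinuous f (-1) 1 /\ {in `](-1), 1[, derive1 f =1 df}.
  move=> fd; split; [split|].
  - by move=> t; rewrite in_itv/= => /andP[? ?]; have [] := fd t; first by lra.
  - by apply: cvg_at_right_filter; apply: (cder _ df); apply: fd; lra.
  - by apply: cvg_at_left_filter; apply: (cder _ df); apply: fd; lra.
  - move=> t; rewrite in_itv/= => /andP[? ?]; rewrite derive1E.
    by have [] := fd t; first by lra.
have [kd1 kd2] := der01 k dk (fun t _ => kd t).
have [Gd1 Gd2] := der01 G g Gd.
have := Rintegration_by_parts lt11 (continuous_subspaceT cdk) kd1 kd2
  (continuous_subspaceT cg) Gd1 Gd2.
rewrite k1 k2 !mul0r subr0 sub0r /unit_int => E.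
have -> : \int[lebesgue_measure]_(t in `[(-1 : R), 1]) (g t * k t) =
    \int[lebesgue_measure]_(t in `[(-1 : R), 1]) (k t * g t).
  by apply: eq_Rintegral => t _; rewrite mulrC.
by rewrite E; congr (- _); apply: eq_Rintegral => t _; rewrite mulrC.
Qed.

End UnitIntegral.


(** * Averages along one coordinate axis *)

Section Averaging.
Context {R : realType} {d : nat}.
Implicit Types (f g : 'rV[R]_d -> R) (x y v : 'rV[R]_d) (j : 'I_d) (k : R -> R).

Local Notation e_ := (delta_mx 0).

Lemma rV_norm_le x (M : R) : 0 <= M -> (`|x| <= M) = [forall j, `|x 0 j| <= M].
Proof.
move=> M0; have -> : `|x| = mx_norm x by [].
rewrite mx_normrE; apply/idP/forallP => [h j|h].
  by apply: le_trans h; exact: (le_bigmax _ (fun ij => `|x ij.1 ij.2|) (0, j)).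
by apply: bigmax_le => // -[i j] _ /=; rewrite ord1.
Qed.

Lemma coord_le_norm x j : `|x 0 j| <= `|x|.
Proof. by have := lexx `|x|; rewrite {1}rV_norm_le// => /forallP. Qed.

Lemma norm_delta_le j : `|e_ j : 'rV[R]_d| <= 1.
Proof.
rewrite rV_norm_le//; apply/forallP => i; rewrite mxE.
by case: (_ && _); rewrite ?normr1 ?normr0.
Qed.

Lemma norm_scale_delta_le (c : R) j : `|c *: e_ j : 'rV[R]_d| <= `|c|.
Proof. by rewrite normrZ ler_piMr// norm_delta_le. Qed.

Variable eta : R.
Hypothesis eta_gt0 : 0 < eta.

(** Applied along every axis in turn, this is convolution with a product kernel of width [eta]. *)
Definition avg k j f x : R := unit_int (fun t => f (x + (eta * t) *: e_ j) * k t).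

Let cont_line L f x j : lip L f -> continuous (fun t : R => f (x + (eta * t) *: e_ j)).
Proof.
move=> fL; have /lip_continuous := lip_line L f x (eta *: e_ j) fL.
by under eq_fun => t do rewrite scalerA mulrC.
Qed.

Lemma avg_lip k j f L : continuous k -> lip L f ->
  lip (L * unit_int (fun t => `|k t|)) (avg k j f).
Proof.
move=> ck fL x y; rewrite /avg -unit_intB; last 2 first.
- by move=> t; apply: cvgM; [exact: (cont_line L f)|exact: ck].
- by move=> t; apply: cvgM; [exact: (cont_line L f)|exact: ck].
under [unit_int _]eq_Rintegral do rewrite -mulrBl.
rewrite mulrAC; apply: normr_unit_intM => //.
  by move=> t; apply: cvgB; exact: (cont_line L f).
move=> t _; apply: le_trans (fL _ _) _.
by rewrite opprD addrACA subrr addr0.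
Qed.

(** The quadratic remainder of [f] has the same constant at every point of the segment, so it can be
    integrated against [k]. *)
Lemma avg_derive_arg k j i f df L : continuous k -> lip L df -> (exists M, lip M f) ->
  (forall y, is_derive y (e_ i) f (df y)) ->
  forall x, is_derive x (e_ i) (avg k j f) (avg k j df x).
Proof.
move=> ck dfL [M fM] fd x.
apply: (is_derive_of_sqr_remainder _ _ _ _
  (L * `|e_ i : 'rV[R]_d| * unit_int (fun t => `|k t|)) 1) => // t _.
have c1 y := cont_line M f y j fM.
have c2 y := cont_line L df y j dfL.
have cM (h1 h2 : R -> R) : continuous h1 -> continuous h2 -> continuous (fun t => h1 t * h2 t).
  by move=> h1c h2c s; apply: cvgM; [exact: h1c|exact: h2c].
have cB (h1 h2 : R -> R) : continuous h1 -> continuous h2 -> continuous (fun t => h1 t - h2 t).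
  by move=> h1c h2c s; apply: cvgB; [exact: h1c|exact: h2c].
have cC (c : R) : continuous (fun _ : R => c) by move=> s; exact: cvg_cst.
rewrite /avg -(unit_intZ t); last by apply: cM.
have H1 := cM _ _ (c1 (x + t *: e_ i)) ck; have H2 := cM _ _ (c1 x) ck.
have H3 := cM _ _ (cC t) (cM _ _ (c2 x) ck).
rewrite -(unit_intB _ _ H1 H2) -(unit_intB _ _ (cB _ _ H1 H2) H3).
under [unit_int _]eq_Rintegral do rewrite mulrA -mulrBl -mulrBl.
rewrite mulrAC; apply: normr_unit_intM => //.
  exact: (cB _ _ (cB _ _ (c1 _) (c1 _)) (cM _ _ (cC t) (c2 _))).
by move=> s _; rewrite [x + _ + _]addrAC; apply: sqr_remainder_line.
Qed.

(** Here [f] is merely Lipschitz. With [G] a primitive of [f] along the axis, integration by parts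
    turns the average into an integral of [G] against [k1]; moving the base point then translates
    [G], whose derivative is [f], and the remainder is quadratic because [f] is Lipschitz. *)
Lemma avg_derive_kernel k k1 j f L : continuous k1 -> lip L f ->
  (forall t : R, is_derive t 1 k (- (eta * k1 t))) -> k (-1) = 0 -> k 1 = 0 ->
  forall x, is_derive x (e_ j) (avg k j f) (avg k1 j f x).
Proof.
move=> ck1 fL kd km kp x.
pose g (u : R) := f (x + (eta * u) *: e_ j).
have ck : continuous k.
  by move=> t; have [/derivable1_diffP /differentiable_continuous] := kd t.
have cg : continuous g by exact: (cont_line L f).
have gL : lip (L * `|eta *: e_ j : 'rV[R]_d|) g.
  have := lip_line L f x (eta *: e_ j) fL.
  by under eq_fun => t do rewrite scalerA mulrC.
(* For [|s| <= 1] and [|t| < 2] the argument [s + t] stays within []-3, 3[], hence inside []-4,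
   4[]. *)
have B0 : 0 < (4 : R) by lra.
have [G [cG Gd]] := antiderivative g 4 cg B0.
have eta0 : eta != 0 by rewrite gt_eqF.
have ca s : continuous (fun t : R => s + t).
  by move=> t; apply: cvgD; [exact: cvg_cst|exact: cvg_id].
have cs (h : R -> R) s : continuous h -> continuous (fun t => h (s + t)).
  by move=> ch t; apply: continuous_comp; [exact: ca|exact: ch].
have cM (h1 h2 : R -> R) : continuous h1 -> continuous h2 -> continuous (fun t => h1 t * h2 t).
  by move=> c1 c2 t; apply: cvgM; [exact: c1|exact: c2].
have parts s : `|s| <= 1 ->
    unit_int (fun t => g (s + t) * k t) =
    eta * unit_int (fun t => G (s + t) * k1 t).
  rewrite ler_norml => /andP[sl sr].
  have cdk : continuous (fun t => - (eta * k1 t)).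
    by move=> t; apply: cvgN; apply: cvgM; [exact: cvg_cst|exact: ck1].
  have Gs (t : R) : -2 < t < 2 -> is_derive t 1 (fun t => G (s + t)) (g (s + t)).
    move=> t2.
    have -> : (fun t => G (s + t)) = (fun t => G (s + t *: 1)).
      by apply/funext => u; rewrite /GRing.scale/= mulr1.
    by apply: is_derive_line; rewrite /GRing.scale/= mulr1; apply: Gd; lra.
  have cGk : continuous (fun t => G (s + t) * k1 t) by apply: cM => //; exact: cs.
  rewrite (unit_int_by_parts _ _ _ _ cdk (cs _ s cg) kd km kp Gs).
  rewrite -(unit_intZ eta)// -mulN1r -unit_intZ; last by apply: cM => //; exact: cs.
  by apply: eq_Rintegral => t _; ring.
set Lg := L * _ in gL.
have eta1 : 0 < eta^-1 by rewrite invr_gt0.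
apply: (is_derive_of_sqr_remainder _ _ _ _
  (eta * (Lg * eta^-1 ^+ 2 * unit_int (fun t => `|k1 t|))) eta) => // t te.
have s1 : `|t / eta| <= 1.
  by rewrite normrM normfV (gtr0_norm eta_gt0) ler_pdivrMr// mul1r.
have -> : avg k j f (x + t *: e_ j) = unit_int (fun s => g (t / eta + s) * k s).
  apply: eq_Rintegral => s _; rewrite /g -addrA -scalerDl.
  by congr (f (_ + _ *: _) * _); field.
have -> : avg k j f x = unit_int (fun s => g (0 + s) * k s).
  by apply: eq_Rintegral => s _; rewrite /g add0r.
rewrite !parts ?normr0//.
have -> : t * avg k1 j f x = eta * unit_int (fun s => t / eta * (g s * k1 s)).
  by rewrite unit_intZ; [rewrite /avg /g; field|exact: cM].
rewrite -!mulrBr.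
have c1 u : continuous (fun s => G (u + s) * k1 s) by apply: cM => //; exact: cs.
have c2 : continuous (fun s => t / eta * (g s * k1 s)).
  by move=> s; apply: cvgM; [exact: cvg_cst|exact: cM].
rewrite -unit_intB// -unit_intB//; last by move=> s; apply: cvgB; exact: c1.
rewrite normrM (gtr0_norm eta_gt0) -mulrA; apply: ler_wpM2l; first exact: ltW.
have -> : unit_int (fun s => G (t / eta + s) * k1 s - G (0 + s) * k1 s - t / eta * (g s * k1 s))
  = unit_int (fun s => (G (t / eta + s) - G (0 + s) - t / eta * g s) * k1 s).
  by apply: eq_Rintegral => s _; ring.
apply: le_trans (_ : Lg * (t / eta) ^+ 2 * unit_int (fun t => `|k1 t|) <= _); last first.
  by rewrite le_eqVlt exprMn; apply/orP; left; apply/eqP; ring.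
have Gc u : continuous (fun s => G (u + s)) by exact: cs.
apply: normr_unit_intM => //.
  move=> s; apply: cvgB; [apply: cvgB; exact: Gc|].
  by apply: cvgM; [exact: cvg_cst|exact: cg].
move=> s /andP[sm sp]; rewrite add0r [t / eta + s]addrC.
have [u [ut]] : exists u, `|u| <= `|t / eta| /\
    G (s + (t / eta) *: 1) - G s = t / eta * g (s + u *: 1).
  apply: MVT_line => u ut; apply: Gd.
  have := le_trans ut s1; rewrite /GRing.scale/= mulr1 ler_norml => /andP[um up].
  by apply/andP; split; lra.
rewrite /GRing.scale/= !mulr1 => ->; rewrite -mulrBr normrM.
rewrite -(@real_normK _ (t / eta)) ?num_real// expr2 mulrCA ler_wpM2l//.
apply: le_trans (gL _ _) _; rewrite [s + u]addrC addrK ler_wpM2l//.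
have := gL 1 0; rewrite subr0 normr1 mulr1; exact: le_trans.
Qed.

End Averaging.

(** * Mollification *)

Section Mollification.
Context {R : realType} {d : nat}.
Implicit Types (f g : 'rV[R]_d -> R) (x y v : 'rV[R]_d) (j : 'I_d) (l s : seq 'I_d).

(** [I] collects the directions averaged so far. Lipschitz bounds are carried along, rather than
    continuity, because the remainder estimates for the next average consume them. *)
Definition lip_pderivs (I : pred 'I_d) f := forall s, all I s ->
  (exists L, lip L (pderivs s f)) /\
  (forall i, I i -> forall x, derivable (pderivs s f) x (delta_mx 0 i)).

(* [k n] is the [n]-th derivative of the kernel [k 0], up to the factor
   [(- eta^-1) ^+ n] that appears when it is rescaled to width [eta]. *)
Definition kernel_tower (eta : R) (k : nat -> R -> R) :=
  [/\ forall n (t : R), is_derive t 1 (k n) (- (eta * k n.+1 t)),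
      forall n, k n (-1) = 0 & forall n, k n 1 = 0].

Definition mollify (eta : R) (k : nat -> R -> R) l f :=
  foldr (avg eta (k 0%N)) f l.

Variables (eta : R) (k : nat -> R -> R).
Hypothesis eta_gt0 : 0 < eta.
Hypothesis kT : kernel_tower eta k.

Let k_cont n : continuous (k n).
Proof.
case: kT => kd _ _ t.
by have [/derivable1_diffP /differentiable_continuous] := kd n t.
Qed.

(** Along the axis of the average the derivative falls on the kernel and raises its level; along any
    other axis it falls on [f]. *)
Lemma is_derive_avg I j f i s n : lip_pderivs I f -> all I s -> (i == j) || I i ->
  forall x, is_derive x (delta_mx 0 i) (avg eta (k n) j (pderivs s f))
    (avg eta (k (n + (i == j))) j (pderivs (if i == j then s else i :: s) f) x).
Proof.
move=> fI sI; have [[L fL] fd] := fI s sI.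
have [kd km kp] := kT.
have [->{i} _|ij /= Ii] := eqVneq i j => x.
  rewrite addn1; apply: (avg_derive_kernel eta eta_gt0 _ _ _ _ L) => //.
have [|[M fM] _] := fI (i :: s); first by rewrite /= Ii.
rewrite addn0; apply: (avg_derive_arg _ _ _ _ _ _ M) => //.
  by exists L.
by move=> y; exact/derivableP/fd.
Qed.

(** The occurrences of [j] in [s] become kernel levels and the other letters act on [f], so [f] is
    differentiated only in directions of [I]. *)
Lemma pderivs_avg I j f s n : lip_pderivs I f -> all [pred i | (i == j) || I i] s ->
  pderivs s (avg eta (k n) j f) =
  avg eta (k (n + count_mem j s)) j (pderivs [seq i <- s | i != j] f).
Proof.
move=> fI; elim: s => [_|i s IH]; first by rewrite addn0.
move=> /= /andP[Ii sI]; rewrite IH//; apply/funext => x.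
have sI' : all I [seq i <- s | i != j].
  rewrite all_filter; apply: sub_all sI => i' /=.
  by case: (eqVneq i' j).
have /= [_ ->] := is_derive_avg I j f i _ (n + count_mem j s) fI sI' Ii x.
by rewrite -addnA [(count_mem _ _ + _)%N]addnC; case: (eqVneq i j).
Qed.

Lemma lip_pderivs_avg I j f : lip_pderivs I f ->
  lip_pderivs [pred i | (i == j) || I i] (avg eta (k 0%N) j f).
Proof.
move=> fI s sI.
have sI' : all I [seq i <- s | i != j].
  rewrite all_filter; apply: sub_all sI => i' /=.
  by case: (eqVneq i' j).
rewrite (pderivs_avg I)//; split.
  have [[L fL] _] := fI _ sI'.
  by eexists; apply: avg_lip => //; exact: fL.
move=> i Ii x.
by have [] := is_derive_avg I j f i _ (0 + count_mem j s) fI sI' Ii x.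
Qed.

Lemma lip_pderivs_mollify l f L : lip L f -> lip_pderivs (mem l) (mollify eta k l f).
Proof.
move=> fL; elim: l => [|j l IH].
  by move=> [|i s]//= _; split; [exists L|].
have := lip_pderivs_avg _ j _ IH.
move=> H s sl; apply: H.
by apply: sub_all sl => i; rewrite /= inE.
Qed.

Hypothesis k_ge0 : forall t, 0 <= k 0%N t.
Hypothesis k_int : unit_int (k 0%N) = 1.

Lemma mollify_lip l f L : lip L f -> lip L (mollify eta k l f).
Proof.
move=> fL; elim: l => [//|j l IH].
have := avg_lip eta (k 0%N) j _ L (@k_cont 0) IH.
suff -> : unit_int (fun t => `|k 0%N t|) = 1 by rewrite mulr1.
rewrite -k_int; apply: eq_Rintegral => t _; exact: ger0_norm.
Qed.

(** Positivity and unit mass of the kernel preserve the inequality; each average moves the base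
    point by at most [eta], hence the radius. Allowing two functions makes upper and lower bounds by
    constants special cases. *)
Lemma le_mollify l f g L M x v (S : R) : lip L f -> lip M g ->
  (forall y, `|y - x| <= (size l)%:R * eta -> f (y + v) <= g y + S) ->
  mollify eta k l f (x + v) <= mollify eta k l g x + S.
Proof.
move=> fL gM; elim: l x => [|j l IH] x fg /=.
  by apply: fg; rewrite subrr normr0 mul0r.
have line (h : 'rV[R]_d -> R) N (z : 'rV[R]_d) :
    lip N h -> continuous (fun t : R => h (z + (eta * t) *: delta_mx 0 j)).
  move=> hN; have /lip_continuous := lip_line N h z (eta *: delta_mx 0 j) hN.
  by under eq_fun => t do rewrite scalerA mulrC.
have c1 := line _ _ (x + v) (mollify_lip l f L fL).
have c2 := line _ _ x (mollify_lip l g M gM).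
have k0c := @k_cont 0%N.
have cM (h1 h2 : R -> R) : continuous h1 -> continuous h2 -> continuous (fun t => h1 t * h2 t).
  by move=> h1c h2c t; apply: cvgM; [exact: h1c|exact: h2c].
have cS : continuous (fun _ : R => S) by move=> t; exact: cvg_cst.
have -> : S = unit_int (fun t => S * k 0%N t) by rewrite unit_intZ// k_int mulr1.
rewrite {1 2}/avg -unit_intD; [|exact: (cM _ _ c2 k0c)|exact: (cM _ _ cS k0c)].
apply: le_unit_int.
- exact: (cM _ _ c1 k0c).
- by move=> t; apply: cvgD; [exact: (cM _ _ c2 k0c)|exact: (cM _ _ cS k0c)].
move=> t /andP[tm tp]; rewrite -mulrDl; apply: ler_wpM2r => //.
rewrite addrAC; apply: IH => y yx; apply: fg.
have -> : y - x = y - (x + (eta * t) *: delta_mx 0 j) + (eta * t) *: delta_mx 0 j.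
  by rewrite opprD addrA subrK.
apply: le_trans (ler_normD _ _) _; rewrite [(size _)%:R]mulrS mulrDl mul1r addrC.
apply: lerD => //; apply: le_trans (norm_scale_delta_le _ _) _.
by rewrite normrM (gtr0_norm eta_gt0) ler_piMr ?(ltW eta_gt0)// ler_norml tm.
Qed.

Lemma mollify_cst l (c : R) x : mollify eta k l (fun=> c) x = c.
Proof.
elim: l x => //= j l IH x; rewrite /avg.
have -> : (fun t => mollify eta k l (fun=> c) (x + (eta * t) *: delta_mx 0 j) * k 0%N t) =
    (fun t => c * k 0%N t) by apply/funext => t; rewrite IH.
by rewrite unit_intZ// k_int mulr1.
Qed.

Lemma mollify_le l f L x (c : R) : lip L f ->
  (forall y, `|y - x| <= (size l)%:R * eta -> f y <= c) -> mollify eta k l f x <= c.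
Proof.
move=> fL fc.
have c0 : lip 0 (fun _ : 'rV[R]_d => c) by move=> ? ?; rewrite subrr normr0 mul0r.
have := le_mollify l f _ L 0 x 0 0 fL c0; rewrite !addr0 mollify_cst; apply=> y yx.
by rewrite !addr0; exact: fc.
Qed.

Lemma mollify_ge l f L x (c : R) : lip L f ->
  (forall y, `|y - x| <= (size l)%:R * eta -> c <= f y) -> c <= mollify eta k l f x.
Proof.
move=> fL fc.
have c0 : lip 0 (fun _ : 'rV[R]_d => c) by move=> ? ?; rewrite subrr normr0 mul0r.
have := le_mollify l _ f 0 L x 0 0 c0 fL; rewrite !addr0 mollify_cst; apply=> y yx.
by rewrite !addr0; exact: fc.
Qed.

End Mollification.

(** * The bump function *)

Section Bump.
Context {R : realType}.

(* All derivatives of the standard bump function [exp (- 1 / (1 - t^2))] are of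
   this form. *)
Definition bump (p : {poly R} * nat) (t : R) : R :=
  if `|t| < 1 then p.1.[t] * (1 - t ^+ 2)^-1 ^+ p.2 * expR (- (1 - t ^+ 2)^-1) else 0.

(** With [S = 1 / (1 - t^2)] and [S' = 2 t S^2], the product rule for [q S^m exp (- S)] gives terms
    in [S^m], [S^(m+1)] and [S^(m+2)]; powers of [1 - t^2] bring them all to [S^(m+2)]. *)
Definition bump_deriv (p : {poly R} * nat) : {poly R} * nat :=
  (p.1^`()%R * (1 - 'X ^+ 2) ^+ 2 + (2 * p.2)%:R *: ('X * p.1 * (1 - 'X ^+ 2)) - 2 *: ('X * p.1),
   p.2.+2).

(** This is [expR (s / n) >= s / n] raised to the power [n]. *)
Lemma expr_le_expR n (s : R) : 0 <= s -> s ^+ n <= n%:R ^+ n * expR s.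
Proof.
move=> s0; case: n => [|n]; first by rewrite !expr0 mul1r (le_trans _ (expR_ge1Dx _))// lerDl.
have n0 : (n.+1%:R : R) != 0 by rewrite pnatr_eq0.
have -> : expR s = expR (s / n.+1%:R) ^+ n.+1.
  by rewrite -expRM_natl; congr expR; field.
rewrite -exprMn lerXn2r ?nnegrE ?mulr_ge0 ?expR_ge0 ?ler0n//.
rewrite mulrC -ler_pdivrMr ?ltr0n//.
by apply: le_trans (expR_ge1Dx _); rewrite lerDr.
Qed.

(** Put [w = 1 - u^2]. Then [w^(-m) exp (- 1 / w)] is at most a constant times [w^2], and
    [w <= 2 |u - t|] once [|t| >= 1]; this gives derivative 0 at the endpoints and outside. *)
Lemma bump_flat p : exists C, forall t u : R, 1 <= `|t| -> `|u - t| <= 1 ->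
  `|bump p u| <= C * (u - t) ^+ 2.
Proof.
case: p => q m; have [B Bq] := poly_itv_bound q (-1) 1.
have B0 : 0 <= B by apply: le_trans (Bq 0 _) => //; rewrite lerN10 ler01.
exists (B * (m.+2%:R ^+ m.+2) * 4) => t u t1 ut.
have C0 : 0 <= B * (m.+2%:R ^+ m.+2) * 4.
  by apply: mulr_ge0 => //; apply: mulr_ge0 => //; apply: exprn_ge0.
rewrite /bump; case: ifPn => [u1|_]; last first.
  by rewrite normr0 mulr_ge0// sqr_ge0.
set w := 1 - u ^+ 2.
have [u1l u1r] : -1 < u /\ u < 1 by move: u1; rewrite ltr_norml => /andP[].
have w0 : 0 < w.
  have -> : w = (1 - u) * (1 + u) by rewrite /w; ring.
  by apply: mulr_gt0; lra.
have wt : w <= 2 * `|u - t|.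
  have -> : w = (1 - u) * (1 + u) by rewrite /w; ring.
  have [t0|t0] := leP 0 t.
    apply: le_trans (_ : (1 - u) * 2 <= _); first by rewrite ler_wpM2l; lra.
    rewrite mulrC ler_wpM2l// distrC (le_trans _ (ler_norm _))//.
    by rewrite lerD2r -(ger0_norm t0).
  apply: le_trans (_ : 2 * (1 + u) <= _); first by rewrite ler_wpM2r; lra.
  rewrite ler_wpM2l// (le_trans _ (ler_norm _))//.
  by rewrite addrC lerD2l -(ltr0_norm t0).
rewrite /= !normrM -!mulrA; apply: ler_pM => //.
- by apply: Bq; rewrite !ltW.
have s0 : 0 < w^-1 by rewrite invr_gt0.
rewrite ger0_norm ?exprn_ge0 ?(ltW s0)// gtr0_norm ?expR_gt0//.
have := expr_le_expR m.+2 _ (ltW s0).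
rewrite expRN => h.
have e0 := expR_gt0 w^-1.
rewrite ler_pdivrMr//.
have -> : w^-1 ^+ m = w^-1 ^+ m.+2 * w ^+ 2.
  rewrite -addn2 exprD -mulrA -exprMn mulVf ?gt_eqF// expr1n mulr1.
  by [].
apply: le_trans (_ : m.+2%:R ^+ m.+2 * expR w^-1 * (4 * (u - t) ^+ 2) <= _).
  apply: ler_pM => //; rewrite ?exprn_ge0 ?(ltW s0) ?(ltW w0)//.
  have -> : 4 * (u - t) ^+ 2 = (2 * `|u - t|) ^+ 2.
    by rewrite exprMn real_normK ?num_real//; congr (_ * _); rewrite expr2; lra.
  by rewrite lerXn2r ?nnegrE ?(ltW w0)// mulr_ge0.
by rewrite mulrAC !mulrA.
Qed.

Lemma is_derive_bump p (t : R) : is_derive t 1 (bump p) (bump (bump_deriv p) t).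
Proof.
have [t1|t1] := ltP `|t| 1; last first.
  have [C Cb] := bump_flat p.
  have -> : bump (bump_deriv p) t = 0 by rewrite /bump ltNge t1.
  apply: (is_derive_of_sqr_remainder _ _ _ _ C 1) => // s s1.
  have -> : bump p t = 0 by rewrite /bump ltNge t1.
  rewrite mulr0 !subr0 [s *: 1]mulr1.
  by have := Cb t (t + s) t1; rewrite [t + s]addrC addrK; apply.
case: p => q m.
pose S (u : R) := (1 - u ^+ 2)^-1.
have w0 : 1 - t ^+ 2 != 0.
  rewrite subr_eq0 eq_sym; apply/eqP => /(congr1 Num.sqrt); rewrite sqrtr_sqr sqrtr1.
  by move=> E; rewrite E ltxx in t1.
have dS : is_derive t 1 S (2 * t * S t ^+ 2).
  have dw : is_derive t 1 (fun u : R => 1 - u ^+ 2) (- (2 * t)).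
    have := is_derive_poly (1 - 'X ^+ 2 : {poly R}) t.
    have -> : horner (1 - 'X ^+ 2 : {poly R}) = (fun u => 1 - u ^+ 2).
      by apply/funext => u; rewrite !hornerE.
    have -> // : (1 - 'X ^+ 2 : {poly R})^`().[t] = - (2 * t).
    by rewrite derivB derivXn derivC sub0r hornerN hornerMn hornerXn expr1 mulr_natl.
  have := @is_deriveV R (fun u : R => 1 - u ^+ 2) t _ 1 w0 dw.
  have -> // : - (1 - t ^+ 2) ^- 2 *: - (2 * t) = 2 * t * S t ^+ 2.
  by rewrite /GRing.scale/= /S mulrNN mulrC exprVn.
have dSm : is_derive t 1 (fun u => S u ^+ m) ((2 * m)%:R * t * S t ^+ m.+1).
  have := is_deriveX m dS.
  have -> : S ^+ m = (fun u => S u ^+ m) by apply/funext => u; rewrite exprfctE.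
  have -> // : (m%:R * S t ^+ m.-1) *: (2 * t * S t ^+ 2) = (2 * m)%:R * t * S t ^+ m.+1.
  rewrite /GRing.scale/= natrM; case: m => [|m]; first by rewrite !(mul0r, mulr0).
  by rewrite /= !exprS expr0; ring.
have dE : is_derive t 1 (fun u => expR (- S u)) (- (2 * t * S t ^+ 2) * expR (- S t)).
  have dN := is_deriveN dS.
  have := @is_derive1_comp R expR (- S) t _ _ (is_derive_expR (- S t)) dN.
  by rewrite mulrC.
have dq := is_derive_poly q t.
have dP := is_deriveM (is_deriveM dq dSm) dE.
have E : {near t, (horner q * (fun u => S u ^+ m)) * (fun u => expR (- S u)) =1 bump (q, m)}.
  near=> u; rewrite /bump ifT//.
  near: u; have : \forall u \near t, `|u| < 1; last by [].
  have : (fun u : R => `|u|) @ t --> `|t| by apply: cvg_norm; exact: cvg_id.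
  by move/cvgr_lt; apply.
have D := near_eq_is_derive E dP; apply: (is_derive_eq D).
have S0 : S t != 0 by rewrite invr_eq0.
have wE : 1 - t ^+ 2 = (S t)^-1 by rewrite /S invrK.
rewrite /bump t1 /GRing.scale /= -[(1 - t ^+ 2)^-1]/(S t) !fctE.
have -> : S t ^+ m.+2 = S t ^+ m * S t ^+ 2 by rewrite -exprD addn2.
rewrite [S t ^+ m.+1]exprSr.
rewrite !(hornerD, hornerN, hornerM, hornerZ, horner_exp, hornerX, hornerC) wE.
move: (S t ^+ m) (S t) S0 => r s s0; field.
Unshelve. all: by end_near. Qed.

End Bump.

(** * Positivity of the mass of the bump and normalisation of the kernel *)

Section Kernel.
Context {R : realType}.

Lemma unit_int_cst (c : R) : unit_int (fun=> c) = c * 2.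
Proof.
have lt11 : (-1 : R) < 1 by lra.
have := @lebesgue_measure_itv R `[-1, 1]; rewrite /= lte_fin lt11 -EFinD opprK => E.
by rewrite /unit_int Rintegral_cst//; congr (_ * _); rewrite -[RHS]/(fine (2%:E)) -E.
Qed.

(** Integrating [1 - t^2] by parts against the primitive [t] of 1 gives [2 - I = 2 I] for the value
    [I]. *)
Lemma unit_int_sqr : unit_int (fun t : R => t ^+ 2) = 2 / 3.
Proof.
have cid : continuous (fun t : R => t) by move=> t; exact: cvg_id.
have csq : continuous (fun t : R => t ^+ 2) by move=> t; apply: cvgM; exact: cvg_id.
have c1 : continuous (fun t : R => 1 : R) by move=> t; exact: cvg_cst.
have dk (t : R) : is_derive t 1 (fun t : R => 1 - t ^+ 2) (- (2 * t)).
  have := is_derive_poly (1 - 'X ^+ 2 : {poly R}) t.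
  have -> : horner (1 - 'X ^+ 2 : {poly R}) = (fun u => 1 - u ^+ 2).
    by apply/funext => u; rewrite !hornerE.
  have -> // : (1 - 'X ^+ 2 : {poly R})^`().[t] = - (2 * t).
  by rewrite derivB derivXn derivC sub0r hornerN hornerMn hornerXn expr1 mulr_natl.
have cdk : continuous (fun t : R => - (2 * t)).
  by move=> t; apply: cvgN; apply: cvgM; [exact: cvg_cst|exact: cvg_id].
have k1 : 1 - (-1) ^+ 2 = 0 :> R by rewrite sqrrN expr1n subrr.
have k2 : 1 - 1 ^+ 2 = 0 :> R by rewrite expr1n subrr.
have := unit_int_by_parts _ _ (fun t => t) (fun=> 1) cdk c1 dk k1 k2 _.
have -> : (fun t : R => 1 * (1 - t ^+ 2)) = (fun t => 1 - t ^+ 2).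
  by apply/funext => t; rewrite mul1r.
have -> : (fun t : R => t * - (2 * t)) = (fun t => - 2 * t ^+ 2).
  by apply/funext => t; ring.
rewrite unit_intB// unit_intZ// unit_int_cst => h.
have {h} := h (fun t _ => is_derive_id t 1); lra.
Qed.

Lemma bump_ge0 t : 0 <= bump (1 : {poly R}, 0%N) t.
Proof.
by rewrite /bump; case: ifP => // _; rewrite hornerC expr0 !mul1r expR_ge0.
Qed.

Lemma bump_continuous (p : {poly R} * nat) : continuous (bump p).
Proof.
by move=> t; have [/derivable1_diffP /differentiable_continuous] := is_derive_bump p t.
Qed.

(** The minorant [exp (- 2) (1 / 2 - t^2)] has integral [exp (- 2) / 3]. It is nonpositive where
    [t^2 >= 1 / 2], and elsewhere [1 / (1 - t^2) <= 2]. *)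
Lemma unit_int_bump_gt0 : 0 < unit_int (bump (1 : {poly R}, 0%N)).
Proof.
pose a : R := expR (- 2).
have a0 : 0 < a by exact: expR_gt0.
have csq : continuous (fun t : R => t ^+ 2) by move=> t; apply: cvgM; exact: cvg_id.
have c1 : continuous (fun t : R => 1 / 2 : R) by move=> t; exact: cvg_cst.
have c2 : continuous (fun t : R => 1 / 2 - t ^+ 2).
  by move=> t; apply: cvgB; [exact: c1|exact: csq].
apply: (@lt_le_trans _ _ (unit_int (fun t : R => a * (1 / 2 - t ^+ 2)))).
  by rewrite unit_intZ// unit_intB// unit_int_cst unit_int_sqr mulr_gt0//; lra.
apply: le_unit_int.
- by move=> t; apply: cvgM; [exact: cvg_cst|exact: c2].
- exact: bump_continuous.
move=> t _; have [t2|t2] := leP (1 / 2) (t ^+ 2).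
  apply: le_trans (bump_ge0 t); rewrite mulr_ge0_le0// ?(ltW a0)//; lra.
have t1 : `|t| < 1.
  rewrite -(@ltr_pXn2r _ 2)// ?nnegrE// real_normK ?num_real// expr1n; lra.
rewrite /bump t1 hornerC expr0 !mul1r.
have w0 : 1 / 2 <= 1 - t ^+ 2 by lra.
apply: (@le_trans _ _ a).
  have t20 := sqr_ge0 t; rewrite ler_piMr ?(ltW a0)//; lra.
rewrite ler_expR lerN2 -[2]invrK lef_pV2 ?posrE; lra.
Qed.

Lemma exists_kernel_tower (eta : R) : 0 < eta -> exists k : nat -> R -> R,
  [/\ kernel_tower eta k, forall t, 0 <= k 0%N t & unit_int (k 0%N) = 1].
Proof.
move=> eta0; set I := unit_int (bump (1 : {poly R}, 0%N)).
have I0 : 0 < I by exact: unit_int_bump_gt0.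
pose step (p : {poly R} * nat) := (- eta^-1 *: (bump_deriv p).1, (bump_deriv p).2).
have bumpZ c (q : {poly R}) m t : bump (c *: q, m) t = c * bump (q, m) t.
  by rewrite /bump; case: ifP => _; rewrite ?mulr0//= hornerZ !mulrA.
have bump1 p (t : R) : 1 <= `|t| -> bump p t = 0 by rewrite /bump leNgt; case: ifP.
exists (fun n => bump (iter n step (I^-1 *: 1, 0%N))); split.
- split=> [n t|n|n]; [|by rewrite bump1 ?normrN1 ?normrN ?normr1..].
  apply: (is_derive_eq (is_derive_bump _ t)).
  by rewrite iterS /step bumpZ mulNr mulrN opprK mulVKf ?gt_eqF.
- by move=> t; rewrite bumpZ mulr_ge0 ?invr_ge0 ?(ltW I0)// bump_ge0.
- rewrite (_ : bump _ = fun t => I^-1 * bump (1 : {poly R}, 0%N) t).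
    by rewrite unit_intZ ?mulVf ?gt_eqF//; exact: bump_continuous.
  by apply/funext => t; rewrite bumpZ.
Qed.

End Kernel.

(** * Taylor remainders and the convex bodies of the Agmon metric *)

Section CoordinatePath.
Context {R : realType} {d : nat}.
Implicit Types (f : 'rV[R]_d -> R) (x y v : 'rV[R]_d).

(** Vertices of the staircase from [x] to [x + v]; each edge is parallel to an axis, so partial
    derivatives suffice along it. *)
Definition coord_path x v (k : nat) : 'rV[R]_d :=
  \row_j (x 0 j + if (j < k)%N then v 0 j else 0).

Lemma coord_pathS x v (k : 'I_d) :
  coord_path x v k.+1 = coord_path x v k + v 0 k *: delta_mx 0 k.
Proof.
apply/rowP => j; rewrite !mxE eqxx /= ltnS.
case: (ltngtP j k) => [jk|kj|/ord_inj ->].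
- by rewrite lt_eqF// mulr0 addr0.
- by rewrite gt_eqF// mulr0 !addr0.
- by rewrite eqxx mulr1 addr0.
Qed.

Lemma coord_path_telescope f x v :
  f (x + v) - f x = \sum_(k < d) (f (coord_path x v k.+1) - f (coord_path x v k)).
Proof.
rewrite -(big_mkord xpredT (fun k => f (coord_path x v k.+1) - f (coord_path x v k))).
rewrite telescope_sumr//; congr (f _ - f _); apply/rowP => j; rewrite !mxE.
  by rewrite ltn_ord.
by rewrite addr0.
Qed.

Lemma coord_path_norm x v k : `|coord_path x v k - x| <= `|v|.
Proof.
rewrite rV_norm_le//; apply/forallP => j; rewrite !mxE addrAC subrr add0r.
by case: ifP => _; rewrite ?normr0// coord_le_norm.
Qed.

Lemma lip_of_partials f (df : 'I_d -> 'rV[R]_d -> R) (B : R) :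
  (forall j x, is_derive x (delta_mx 0 j) f (df j x)) ->
  (forall j x, `|df j x| <= B) -> lip (d%:R * B) f.
Proof.
move=> fd fB y x; rewrite -[y in f y](subrK x) [_ + x]addrC coord_path_telescope.
apply: le_trans (ler_norm_sum _ _ _) _.
apply: le_trans (_ : \sum_(k < d) B * `|y - x| <= _); last first.
  by rewrite sumr_const card_ord -[_ *+ d]mulr_natl mulrA.
apply: ler_sum => k _; rewrite coord_pathS.
have [s [_ ->]] := MVT_line f (df k) (coord_path x (y - x) k) (delta_mx 0 k)
  ((y - x) 0 k) (fun s _ => fd _ _).
by rewrite normrM mulrC ler_pM// coord_le_norm.
Qed.

(** The mean value point on each edge is within [2 |v|] of [x]: one [|v|] for the vertex, one for
    the position on the edge. Hence the factor 2. *)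
Lemma sqr_remainder f (df : 'I_d -> 'rV[R]_d -> R) (L : R) : 0 <= L ->
  (forall j x, is_derive x (delta_mx 0 j) f (df j x)) ->
  (forall j, lip L (df j)) -> forall x v,
  `|f (x + v) - f x - \sum_(j < d) df j x * v 0 j| <= d%:R * (2 * L) * `|v| ^+ 2.
Proof.
move=> L0 fd dfL x v; rewrite coord_path_telescope -sumrB.
apply: le_trans (ler_norm_sum _ _ _) _.
apply: le_trans (_ : \sum_(k < d) (2 * L) * `|v| ^+ 2 <= _); last first.
  by rewrite sumr_const card_ord -[_ *+ d]mulr_natl mulrA.
apply: ler_sum => k _; rewrite coord_pathS.
have [s [st ->]] := MVT_line f (df k) (coord_path x v k) (delta_mx 0 k)
  (v 0 k) (fun s _ => fd _ _).
have vk := coord_le_norm v k.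
rewrite [df k x * _]mulrC -mulrBr normrM expr2 mulrCA ler_pM//.
apply: le_trans (dfL _ _ _) _; rewrite [2 * L]mulrC -mulrA ler_wpM2l//.
rewrite addrAC mulr_natl mulr2n; apply: le_trans (ler_normD _ _) _.
rewrite lerD ?coord_path_norm//; apply: le_trans (norm_scale_delta_le _ _) _.
exact: le_trans st vk.
Qed.

End CoordinatePath.

(** * Convexity of the sinh energy and support functions of its sublevel sets *)

Section SinhBody.
Context {R : realType} {d : nat}.
Implicit Types (p v w xi : 'rV[R]_d) (a b t : R).

Lemma sinh_half_sqr t : sinh (t / 2) ^+ 2 = (expR t + expR (- t) - 2) / 4.
Proof.
have -> : expR t = expR (t / 2) ^+ 2 by rewrite -expRM_natl; congr expR; field.
have -> : expR (- t) = expR (- (t / 2)) ^+ 2 by rewrite -expRM_natl; congr expR; field.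
have := expRxMexpNx_1 (t / 2); rewrite /sinh.
move: (expR (t / 2)) (expR (- (t / 2))) => u v uv.
by transitivity ((u ^+ 2 + v ^+ 2 - 2 * (u * v)) / 4); [field|rewrite uv mulr1].
Qed.

(** Tangent line inequality for [(e^t + e^(-t) - 2) / 4], from [e^x >= 1 + x] applied to both
    exponentials. *)
Lemma sinh_half_sqr_tangent s t :
  sinh (t / 2) ^+ 2 + (expR t - expR (- t)) / 4 * (s - t) <= sinh (s / 2) ^+ 2.
Proof.
rewrite !sinh_half_sqr.
have h1 : expR t * (1 + (s - t)) <= expR s.
  have -> : expR s = expR t * expR (s - t) by rewrite -expRD addrC subrK.
  by rewrite ler_wpM2l ?expR_ge0// expR_ge1Dx.
have h2 : expR (- t) * (1 - (s - t)) <= expR (- s).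
  have -> : - s = - t + - (s - t) by ring.
  by rewrite expRD ler_wpM2l ?expR_ge0// expR_ge1Dx.
move: (expR t) (expR (- t)) (expR s) (expR (- s)) h1 h2 => x y z w h1 h2; lra.
Qed.

Lemma sqr_le_sinh_half_sqr t : t ^+ 2 <= 16 * sinh (t / 2) ^+ 2.
Proof.
have pos (s : R) : 0 <= s -> s / 2 <= sinh s.
  move=> s0; have h1 := expR_ge1Dx s.
  have h2 : expR (- s) <= (1 + s)^-1 by rewrite expRN lef_pV2 ?posrE ?expR_gt0//; lra.
  have h3 : (1 + s)^-1 <= 1.
    by rewrite invf_le1; lra.
  rewrite /sinh; lra.
have sqr (s : R) : 0 <= s -> s ^+ 2 <= 4 * sinh s ^+ 2.
  move=> s0; have := pos s s0; move: (sinh s) => u su; nra.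
have -> : t ^+ 2 = 4 * (t / 2) ^+ 2 by field.
have [t0|t0] := leP 0 t.
  have := sqr (t / 2) ltac:(lra); lra.
have -> : sinh (t / 2) ^+ 2 = sinh (- t / 2) ^+ 2.
  by rewrite !sinh_half_sqr opprK [expR t + _]addrC.
have := sqr (- t / 2) ltac:(lra); rewrite mulNr sqrrN; lra.
Qed.

Definition sinh_energy xi : R := \sum_(j < d) sinh (xi 0 j / 2) ^+ 2.

Lemma sinh_energy_ge0 xi : 0 <= sinh_energy xi.
Proof. by apply: sumr_ge0 => j _; exact: sqr_ge0. Qed.

Lemma sinh_energy0 : sinh_energy 0 = 0.
Proof.
apply: big1 => j _; rewrite mxE sinh_half_sqr oppr0 expR0; lra.
Qed.

Lemma sinh_energyN xi : sinh_energy (- xi) = sinh_energy xi.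
Proof.
by apply: eq_bigr => j _; rewrite !mxE !sinh_half_sqr opprK [expR (- _) + _]addrC.
Qed.

Definition sinh_energy_grad xi : 'rV[R]_d :=
  \row_j ((expR (xi 0 j) - expR (- xi 0 j)) / 4).

Lemma sinh_energy_tangent p xi :
  sinh_energy p + eucl_dot (sinh_energy_grad p) (xi - p) <= sinh_energy xi.
Proof.
rewrite /sinh_energy /eucl_dot -big_split; apply: ler_sum => j _.
by rewrite !mxE; exact: sinh_half_sqr_tangent.
Qed.

Lemma eucl_dotC v w : eucl_dot v w = eucl_dot w v.
Proof. by apply: eq_bigr => j _; rewrite mulrC. Qed.

Lemma eucl_dotDl p v w : eucl_dot (v + w) p = eucl_dot v p + eucl_dot w p.
Proof. by rewrite /eucl_dot -big_split; apply: eq_bigr => j _; rewrite mxE mulrDl. Qed.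

Lemma eucl_dotZl t v w : eucl_dot (t *: v) w = t * eucl_dot v w.
Proof. by rewrite /eucl_dot mulr_sumr; apply: eq_bigr => j _; rewrite mxE mulrA. Qed.

Lemma eucl_dotDr p v w : eucl_dot p (v + w) = eucl_dot p v + eucl_dot p w.
Proof. by rewrite !(eucl_dotC p) eucl_dotDl. Qed.

Lemma eucl_dotZr t v w : eucl_dot w (t *: v) = t * eucl_dot w v.
Proof. by rewrite !(eucl_dotC w) eucl_dotZl. Qed.

Lemma eucl_dotNr v w : eucl_dot w (- v) = - eucl_dot w v.
Proof. by rewrite -scaleN1r eucl_dotZr mulN1r. Qed.

Lemma eucl_dotNl v w : eucl_dot (- w) v = - eucl_dot w v.
Proof. by rewrite -scaleN1r eucl_dotZl mulN1r. Qed.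

(** The tangent at [t *: xi], evaluated at [xi] and at 0 and combined with weights [t] and [1 - t],
    gives the claim because the energy vanishes at 0. *)
Lemma sinh_energy_scale t xi : 0 <= t <= 1 -> sinh_energy (t *: xi) <= t * sinh_energy xi.
Proof.
move=> /andP[t0 t1].
have h1 := sinh_energy_tangent (t *: xi) xi.
have h2 := sinh_energy_tangent (t *: xi) 0.
rewrite sinh_energy0 sub0r eucl_dotNr eucl_dotZr in h2.
rewrite -[xi in xi - _]scale1r -scalerBl eucl_dotZr in h1.
move: (eucl_dot _ _) (sinh_energy (t *: xi)) (sinh_energy xi) h1 h2 => D A B h1 h2.
nra.
Qed.

(** The Agmon-Finsler metric with the level as a free parameter; [agmon_finsler] at [x] is its value
    at level [(V x - E)_+ / 4]. *)
Definition sinh_support a v : R := sup [set eucl_dot xi v | xi in [set xi | sinh_energy xi <= a]].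

Lemma eucl_dot_le_energy a xi v : sinh_energy xi <= a ->
  eucl_dot xi v <= (4 * d)%:R * Num.sqrt a * `|v|.
Proof.
move=> xia; have a0 := le_trans (sinh_energy_ge0 xi) xia.
apply: le_trans (_ : \sum_(j < d) (4 * Num.sqrt a) * `|v| <= _); last first.
  by rewrite sumr_const card_ord -[_ *+ d]mulr_natl natrM !mulrA [d%:R * 4]mulrC.
apply: ler_sum => j _; apply: le_trans (ler_norm _) _; rewrite normrM.
rewrite ler_pM ?coord_le_norm//.
rewrite -(@ler_pXn2r _ 2) ?nnegrE ?mulr_ge0 ?sqrtr_ge0//.
rewrite real_normK ?num_real// exprMn sqr_sqrtr//.
apply: le_trans (sqr_le_sinh_half_sqr _) _.
have -> : 4 ^+ 2 = 16 :> R by rewrite expr2; lra.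
rewrite ler_wpM2l//; apply: le_trans xia.
rewrite /sinh_energy (bigD1 j)//= lerDl sumr_ge0// => i _; exact: sqr_ge0.
Qed.

Lemma sinh_support_ub a xi v : sinh_energy xi <= a -> eucl_dot xi v <= sinh_support a v.
Proof.
move=> xia; apply: sup_ubound; last by exists xi.
exists ((4 * d)%:R * Num.sqrt a * `|v|) => _ [z za <-].
exact: eucl_dot_le_energy.
Qed.

Lemma sinh_support_le a v S : 0 <= a ->
  (forall xi, sinh_energy xi <= a -> eucl_dot xi v <= S) -> sinh_support a v <= S.
Proof.
move=> a0 h; apply: ge_sup => [|_ [xi xia <-]]; last exact: h.
by exists (eucl_dot 0 v), 0 => //=; rewrite sinh_energy0.
Qed.

Lemma sinh_support_ge0 a v : 0 <= a -> 0 <= sinh_support a v.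
Proof.
move=> a0; have := @sinh_support_ub a 0 v; rewrite sinh_energy0 => /(_ a0).
by rewrite /eucl_dot big1// => j _; rewrite mxE mul0r.
Qed.

Lemma sinh_support_le_norm a v : 0 <= a ->
  sinh_support a v <= (4 * d)%:R * Num.sqrt a * `|v|.
Proof. by move=> a0; apply: sinh_support_le => // xi; exact: eucl_dot_le_energy. Qed.

Lemma sinh_support_mono a b v : 0 <= a -> a <= b -> sinh_support a v <= sinh_support b v.
Proof.
move=> a0 ab; apply: sinh_support_le => // xi xia; apply: sinh_support_ub.
exact: le_trans ab.
Qed.

(* [(a / b) K_b] is contained in [K_a] by convexity. *)
Lemma sinh_support_holder a b v : 0 <= a -> a <= b ->
  sinh_support b v <= sinh_support a v + (4 * d)%:R * Num.sqrt (b - a) * `|v|.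
Proof.
move=> a0 ab; have b0 := le_trans a0 ab.
have [b0'|bpos] := leP b 0.
  have -> : b = a by lra.
  by rewrite lerDl !mulr_ge0// sqrtr_ge0.
apply: sinh_support_le => // xi xib.
have ab1 : 0 <= a / b <= 1 by rewrite divr_ge0//= ler_pdivrMr// mul1r.
have h1 : a / b * eucl_dot xi v <= sinh_support a v.
  rewrite -eucl_dotZl; apply: sinh_support_ub.
  apply: le_trans (sinh_energy_scale _ _ ab1) _.
  apply: le_trans (_ : a / b * b <= _); last by rewrite divfK// gt_eqF.
  by rewrite ler_wpM2l// (andP ab1).1.
have h2 := eucl_dot_le_energy _ _ v xib.
rewrite -[eucl_dot xi v in X in X <= _](subrK (a / b * eucl_dot xi v)) addrC.
apply: lerD => //; rewrite -{1}[eucl_dot xi v]mul1r -mulrBl.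
have ab2 : 0 <= 1 - a / b <= 1 by case/andP: ab1 => ? ?; apply/andP; split; lra.
apply: le_trans (_ : (1 - a / b) * ((4 * d)%:R * Num.sqrt b * `|v|) <= _).
  by rewrite ler_wpM2l// (andP ab2).1.
rewrite [leLHS]mulrCA [(4 * d)%:R * _ * _]mulrAC -!mulrA; apply: ler_wpM2l => //.
(* What remains is [(b - a) / sqrt b <= sqrt (b - a)], which holds because [b - a <= b]. *)
have -> : 1 - a / b = (b - a) / b by rewrite mulrBl divff// gt_eqF.
have sb : 0 < Num.sqrt b by rewrite sqrtr_gt0.
have bE : b = Num.sqrt b * Num.sqrt b by rewrite -expr2 sqr_sqrtr.
have cE : b - a = Num.sqrt (b - a) * Num.sqrt (b - a) by rewrite -expr2 sqr_sqrtr// subr_ge0.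
have sr : Num.sqrt (b - a) <= Num.sqrt b by rewrite ler_wsqrtr//; lra.
have -> : Num.sqrt b * ((b - a) / b * `|v|) =
    Num.sqrt (b - a) / Num.sqrt b * (Num.sqrt (b - a) * `|v|).
  rewrite {1}cE; have -> : b^-1 = (Num.sqrt b)^-1 * (Num.sqrt b)^-1.
    by rewrite {1}bE invfM.
  by field; rewrite gt_eqF.
by rewrite [`|v| * _]mulrC ler_piMl ?mulr_ge0 ?sqrtr_ge0// ler_pdivrMr// mul1r.
Qed.

Lemma sinh_support_triangle a v w : 0 <= a ->
  sinh_support a (v + w) <= sinh_support a v + sinh_support a w.
Proof.
move=> a0; apply: sinh_support_le => // xi xia.
by rewrite eucl_dotDr lerD// sinh_support_ub.
Qed.

Lemma sinh_support_scale a t v : 0 <= a ->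
  sinh_support a (t *: v) <= `|t| * sinh_support a v.
Proof.
move=> a0; apply: sinh_support_le => // xi xia; rewrite eucl_dotZr.
have [t0|t0] := leP 0 t; first by rewrite ger0_norm// ler_wpM2l// sinh_support_ub.
have -> : t * eucl_dot xi v = `|t| * eucl_dot (- xi) v.
  by rewrite eucl_dotNl ltr0_norm// mulrNN.
rewrite ler_wpM2l//.
by apply: sinh_support_ub; rewrite sinh_energyN.
Qed.

(* [K_a] is recovered from its support function by testing against the
   gradient of the energy at [p]. *)
Lemma sinh_energy_le_of_support a p : 0 <= a ->
  (forall w, eucl_dot p w <= sinh_support a w) -> sinh_energy p <= a.
Proof.
move=> a0 h; set w := sinh_energy_grad p.
have : sinh_support a w <= eucl_dot p w - (sinh_energy p - a).
  apply: sinh_support_le => // xi xia; have := sinh_energy_tangent p xi.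
  rewrite eucl_dotDr eucl_dotNr eucl_dotC -/w [eucl_dot w p]eucl_dotC; lra.
have := h w; lra.
Qed.

End SinhBody.

(** * Finsler lengths of curves *)

Section PositivePart.
Context {R : realType}.

Definition pos_part (t : R) : R := Num.max t 0.

Lemma pos_part_ge0 t : 0 <= pos_part t. Proof. by rewrite le_max lexx orbT. Qed.

Lemma pos_part_lip : lip 1 pos_part.
Proof.
move=> s t; rewrite mul1r /pos_part ler_norml.
have h1 := ler_norm (s - t); have h2 := ler_norm (t - s); rewrite distrC in h2.
by case: (leP s 0) => ?; case: (leP t 0) => ?; apply/andP; split; lra.
Qed.

(** The squared positive part is of class C^1, hence an explicit C^1 cutoff in the curve
    parameter. *)
Lemma pos_part_sqr_remainder (u k : R) :
  `|pos_part (u + k) ^+ 2 - pos_part u ^+ 2 - 2 * k * pos_part u| <= k ^+ 2.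
Proof.
rewrite /pos_part ler_norml.
by case: (leP u 0) => ?; case: (leP (u + k) 0) => ?; apply/andP; split; nra.
Qed.

Lemma is_derive_pos_part_sqr (a b t : R) :
  is_derive t 1 (fun s => pos_part (a + b * s) ^+ 2) (2 * b * pos_part (a + b * t)).
Proof.
apply: (is_derive_of_sqr_remainder _ _ _ _ (b ^+ 2) 1) => // h _.
rewrite [h *: 1]mulr1 mulrDr addrA -exprMn.
have -> : h * (2 * b * pos_part (a + b * t)) = 2 * (b * h) * pos_part (a + b * t) by ring.
exact: pos_part_sqr_remainder.
Qed.

Lemma cvg_slope_of_sqr_remainder (b : R -> R) (t p M : R) :
  (forall s, `|b s - b t - (s - t) * p| <= M * (s - t) ^+ 2) ->
  (s - t)^-1 * (b s - b t) @[s --> t^'] --> p.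
Proof.
move=> bM.
have M0 : 0 <= M.
  by have := bM (t + 1); rewrite [t + 1]addrC addrK expr1n mulr1; exact: le_trans.
have M1 : 0 < M + 1 by rewrite ltr_wpDl.
apply/cvgrPdist_le => e e0; near=> s.
have s0 : s - t != 0 by rewrite subr_eq0; near: s; exact: nbhs_dnbhs_neq.
have -> : p - (s - t)^-1 * (b s - b t) = - ((s - t)^-1 * (b s - b t - (s - t) * p)).
  by field.
rewrite normrN normrM normfV ler_pdivrMl ?normr_gt0//; apply: le_trans (bM s) _.
rewrite -(@real_normK _ (s - t)) ?num_real// expr2 mulrCA ler_wpM2l//.
apply: le_trans (_ : (M + 1) * (e / (M + 1)) <= _); last by rewrite mulrC divfK// gt_eqF.
apply: ler_pM => //; first by rewrite lerDl.
near: s; apply: nbhs_dnbhs.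
have : \forall s \near t, `|t - s| <= e / (M + 1).
  exact: (cvgr_dist_le _ _ (@cvg_id _ (nbhs t)) _ (divr_gt0 e0 M1)).
by apply: filterS => s; rewrite distrC.
Unshelve. all: by end_near. Qed.

End PositivePart.

(** * Regularity of the Agmon-Finsler metric *)

Section Finsler.
Context {R : realType} {d : nat}.
Variables (V : 'rV[R]_d -> R) (E LV MV : R).
Hypothesis V_lip : lip LV V.
Hypothesis V_bound : forall x, `|V x| <= MV.
Hypothesis LV_ge0 : 0 <= LV.
Implicit Types (x y v w : 'rV[R]_d).

Local Notation L := (agmon_finsler V E).

Definition amplitude x : R := Num.max (V x - E) 0 / 4.

Lemma agmon_finslerE x v : L x v = sinh_support (amplitude x) v.
Proof. by []. Qed.

Lemma amplitude_ge0 x : 0 <= amplitude x.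
Proof. by rewrite divr_ge0// le_max lexx orbT. Qed.

Lemma amplitude_lip x y : amplitude x <= amplitude y + LV * `|x - y|.
Proof.
have := le_trans (ler_norm _) (V_lip x y); set D := LV * _ => h.
have D0 : 0 <= D by rewrite mulr_ge0.
by rewrite /amplitude; case: (leP (V x - E) 0) => ?; case: (leP (V y - E) 0) => ?; lra.
Qed.

(** Coordinates of points in the body of level [a] are at most [4 sqrt a], and every level is at
    most [MV + |E|]. *)
Definition finsler_const : R := (4 * d)%:R * Num.sqrt (MV + `|E|).

Lemma finsler_const_ge0 : 0 <= finsler_const.
Proof. by rewrite mulr_ge0// sqrtr_ge0. Qed.

Lemma finsler_ge0 x v : 0 <= L x v.
Proof. by rewrite agmon_finslerE sinh_support_ge0 ?amplitude_ge0. Qed.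

Lemma finsler_le_norm x v : L x v <= finsler_const * `|v|.
Proof.
rewrite agmon_finslerE; apply: le_trans (sinh_support_le_norm _ _ (amplitude_ge0 _)) _.
rewrite ler_wpM2r// ler_wpM2l// ler_wsqrtr//.
have := le_trans (ler_norm _) (V_bound x); have := ler_norm (- E); rewrite normrN.
have := normr_ge0 (V x); have := V_bound x; have := normr_ge0 E.
by rewrite /amplitude; case: (leP (V x - E) 0) => ?; lra.
Qed.

(** The exponent 1/2 reflects that the body of level [a] has size of order [sqrt a] near [a = 0]. *)
Lemma finsler_holder x y v :
  L x v <= L y v + (4 * d)%:R * Num.sqrt (LV * `|x - y|) * `|v|.
Proof.
rewrite !agmon_finslerE; have [xy|yx] := leP (amplitude x) (amplitude y).
  apply: le_trans (sinh_support_mono _ _ _ (amplitude_ge0 _) xy) _.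
  by rewrite lerDl !mulr_ge0// sqrtr_ge0.
apply: le_trans (sinh_support_holder _ _ _ (amplitude_ge0 y) (ltW yx)) _.
rewrite lerD2l ler_wpM2r// ler_wpM2l// ler_wsqrtr//.
by rewrite lerBlDl amplitude_lip.
Qed.

Lemma finsler_triangle x v w : L x (v + w) <= L x v + L x w.
Proof. by rewrite !agmon_finslerE sinh_support_triangle ?amplitude_ge0. Qed.

Lemma finsler_scale x t v : L x (t *: v) <= `|t| * L x v.
Proof. by rewrite !agmon_finslerE sinh_support_scale ?amplitude_ge0. Qed.

Lemma finsler_dist x y v w : `|L x v - L y w| <=
  finsler_const * `|v - w| + (4 * d)%:R * Num.sqrt (LV * `|x - y|) * `|w|.
Proof.
have h1 : L x v <= L x w + finsler_const * `|v - w|.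
  rewrite -[v in leLHS](subrK w) addrC.
  by apply: le_trans (finsler_triangle _ _ _) _; rewrite lerD2l finsler_le_norm.
have h2 : L x w <= L x v + finsler_const * `|v - w|.
  rewrite -[w in leLHS](subrK v) addrC distrC.
  by apply: le_trans (finsler_triangle _ _ _) _; rewrite lerD2l finsler_le_norm.
have h3 := finsler_holder x y w; have h4 := finsler_holder y x w.
rewrite distrC in h4; rewrite ler_norml; apply/andP; split; lra.
Qed.

Lemma C1_curve_continuous (c c' : R -> 'rV[R]_d) :
  C1_curve c c' -> {within `[(0 : R), 1], continuous c}.
Proof.
move=> [cd _]; apply/subspace_continuousP => t; rewrite /= => t01.
have q := cd t t01.
have FF : Filter (within `[(0 : R), 1]%classic t^') by exact: within_filter.
have st : (s - t) @[s --> within [set` `[(0 : R), 1]] t^'] --> (0 : R).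
  rewrite -(subrr t); apply: cvgB; last exact: cvg_cst.
  by apply: cvg_within_filter; apply: cvg_within_filter; exact: cvg_id.
have ct := cvgD (cvgZ st q) (@cvg_cst _ (c t) _ _ FF).
have {}ct := ct FF FF; rewrite scale0r add0r in ct.
apply/cvgrPdist_le => e e0; move/cvgrPdist_le : ct => /(_ e e0).
rewrite /prop_near1/= /within/= => H.
have {}H : nbhs t (fun s => s != t -> `[(0 : R), 1]%classic s ->
  `|c t - ((s - t) *: ((s - t)^-1 *: (c s - c t)) + c t)| <= e) := H.
apply: filterS H => s H s01; have [->|st'] := eqVneq s t.
  by rewrite subrr normr0 ltW.
have := H st' s01.
by rewrite scalerA divff ?subr_eq0// scale1r subrK.
Qed.

Lemma finsler_curve_continuous (c c' : R -> 'rV[R]_d) : C1_curve c c' ->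
  {within `[(0 : R), 1], continuous (fun t => L (c t) (c' t))}.
Proof.
move=> cc; have cct := C1_curve_continuous _ _ cc; have [_ c'c] := cc.
apply/subspace_continuousP => t t01.
have ct := (@subspace_continuousP _ _ _ _).1 cct t t01.
have c't := (@subspace_continuousP _ _ _ _).1 c'c t t01.
have B0 : (finsler_const * `|c' s - c' t| + (4 * d)%:R * Num.sqrt (LV * `|c s - c t|) * `|c' t|)
    @[s --> within `[(0 : R), 1]%classic (nbhs t)] --> (0 : R).
  rewrite -[0 in X in _ --> X](_ : finsler_const * `|c' t - c' t| +
    (4 * d)%:R * Num.sqrt (LV * `|c t - c t|) * `|c' t| = 0); last first.
    by rewrite !subrr !normr0 !mulr0 sqrtr0 !mulr0 mul0r addr0.
  apply: cvgD; first apply: cvgM; first exact: cvg_cst.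
    by apply: cvg_norm; apply: cvgB => //; exact: cvg_cst.
  apply: cvgM; last exact: cvg_cst.
  apply: cvgM; first exact: cvg_cst.
  apply: (@continuous_cvg _ _ _ _ _ (fun s => LV * `|c s - c t|) Num.sqrt (LV * `|c t - c t|)).
    exact: sqrt_continuous.
  apply: cvgM; first exact: cvg_cst.
  by apply: cvg_norm; apply: cvgB => //; exact: cvg_cst.
apply/cvgrPdist_le => e e0; move/cvgrPdist_le : B0 => /(_ e e0); apply: filterS => s.
rewrite sub0r normrN => /(le_trans (ler_norm _)); apply: le_trans.
by rewrite distrC; exact: finsler_dist.
Qed.

End Finsler.

(** * Distance to the allowed region and its growth along a displacement *)

Section AgmonDistance.
Context {R : realType} {d : nat}.
Variables (V : 'rV[R]_d -> R) (E LV MV : R).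
Hypothesis V_lip : lip LV V.
Hypothesis V_bound : forall x, `|V x| <= MV.
Hypothesis LV_ge0 : 0 <= LV.
Implicit Types (x y v w : 'rV[R]_d) (c : R -> 'rV[R]_d).

Local Notation L := (agmon_finsler V E).
Local Notation K := (@finsler_const R d E MV).

Lemma Rintegral_pos_part (tau : R) : 0 < tau <= 1 ->
  \int[lebesgue_measure]_(t in `[(0 : R), 1]) pos_part (1 - t / tau) = tau / 2.
Proof.
move=> /andP[tau0 tau1]; have tn0 : tau != 0 by rewrite gt_eqF.
pose F (t : R) := - (tau / 2) * pos_part (1 + - tau^-1 * t) ^+ 2.
have dF (t : R) : is_derive t 1 F (pos_part (1 - t / tau)).
  have := is_deriveZ (- (tau / 2)) (is_derive_pos_part_sqr 1 (- tau^-1) t).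
  have -> : - (tau / 2) *: (2 * - tau^-1 * pos_part (1 + - tau^-1 * t)) = pos_part (1 - t / tau).
    rewrite /GRing.scale/= [- tau^-1 * t]mulNr [tau^-1 * t]mulrC; field; exact: tn0.
  by [].
have cF (t : R) : F s @[s --> t] --> F t.
  by have [/derivable1_diffP /differentiable_continuous] := dF t.
have cp : continuous (fun t : R => pos_part (1 - t / tau)).
  move=> t; apply: (@continuous_cvg _ _ _ _ _ (fun t => 1 - t / tau) pos_part).
    exact: (lip_continuous 1 _ pos_part_lip).
  by apply: cvgB; [exact: cvg_cst|apply: cvgM; [exact: cvg_id|exact: cvg_cst]].
have lt01 : (0 : R) < 1 by lra.
have dd : derivable_oo_LRcontinuous F 0 1.
  split; first by move=> t _; have [] := dF t.
  - by apply: cvg_at_right_filter; exact: cF.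
  - by apply: cvg_at_left_filter; exact: cF.
have ddE : {in `]0, 1[, derive1 F =1 (fun t => pos_part (1 - t / tau))}.
  by move=> t _; rewrite derive1E; have [] := dF t.
have := continuous_FTC2 lt01 (continuous_subspaceT cp) dd ddE.
rewrite /Rintegral => ->; rewrite -EFinB /= /F mulr0 addr0 mulr1.
rewrite [pos_part (1 + _)]max_r; last by rewrite subr_le0 invf_ge1.
rewrite [pos_part 1]max_l ?ler01// expr0n expr1n /=; lra.
Qed.

(** Take [c1 = c + b v] with [b = p^2] and [p = (1 - t / tau)_+]. The velocity [b' v] costs at most
    [S], since [|b'|] integrates to 1 and [c1] stays within [|v| + r] of [c 0] while [b'] is
    nonzero. Moving the base point costs [C p], because the Hölder bound takes the square root of
    [b]; this integrates to [C tau / 2], small with [tau]. *)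
Lemma perturb_curve c c' v (S r e : R) :
  C1_curve c c' -> 0 < r -> 0 < e ->
  (forall y, `|y - c 0| <= `|v| + r -> L y v <= S) ->
  exists c1 c1', [/\ C1_curve c1 c1', c1 0 = c 0 + v, c1 1 = c 1 &
    agmon_length V E c1 c1' <= agmon_length V E c c' + S + e].
Proof.
move=> cc r0 e0 hS.
have S0 : 0 <= S.
  apply: le_trans (finsler_ge0 V E (c 0) v) (hS _ _).
  by rewrite subrr normr0 addr_ge0// ltW.
have cct := C1_curve_continuous _ _ cc; have [cd c'c] := cc.
have le01 : (0 : R) <= 1 by [].
have [M0 M1] : exists M, forall t : R, 0 <= t <= 1 -> `|c' t| <= M.
  have cn : {within `[(0 : R), 1], continuous (fun t => `|c' t|)}.
    apply/subspace_continuousP => t t01; apply: cvg_norm.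
    exact: (@subspace_continuousP _ _ _ _).1 c'c t t01.
  have [t _ h] := EVT_max le01 cn; exists `|c' t| => s s01; apply: h.
  by rewrite in_itv.
have M00 : 0 <= M0 by apply: le_trans (M1 0 _); rewrite // lexx.
have [tau0 [tau00 htau0]] : exists tau0 : R, 0 < tau0 /\
    forall t, 0 <= t -> t < tau0 -> t <= 1 -> `|c t - c 0| <= r.
  have := (@subspace_continuousP _ _ _ _).1 cct 0 _.
  rewrite /= in_itv /= lexx ler01 => /(_ isT) /cvgrPdist_le /(_ r r0) H.
  have {}H : nbhs (0 : R) (fun s => `[(0 : R), 1]%classic s -> `|c 0 - c s| <= r) := H.
  have [tau /= t0 Ht] := H; exists tau; split=> // t tge tlt t1.
  rewrite distrC; apply: Ht; last by rewrite /= in_itv/= tge.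
  by rewrite /= sub0r normrN ger0_norm.
pose C := (4 * d)%:R * Num.sqrt (LV * `|v|) * M0.
have C0 : 0 <= C by rewrite !mulr_ge0// sqrtr_ge0.
have C1 : 0 < C + 1 by rewrite ltr_wpDl.
pose tau := Num.min (Num.min tau0 1) (e / (C + 1)).
have tau_gt0 : 0 < tau by rewrite !lt_min tau00 ltr01 divr_gt0.
have tau_le1 : tau <= 1 by rewrite !ge_min lexx orbT.
have tau_le0 : tau <= tau0 by rewrite !ge_min lexx.
have tau_leC : C * tau <= e.
  apply: le_trans (_ : (C + 1) * (e / (C + 1)) <= _); last by rewrite mulrC divfK// gt_eqF.
  by rewrite ler_pM ?(ltW tau_gt0)//; [lra|rewrite ge_min lexx orbT].
have tn0 : tau != 0 by rewrite gt_eqF.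
pose p (t : R) := pos_part (1 - t / tau).
have p0 t : 0 <= p t by exact: pos_part_ge0.
have p1 t : 0 <= t -> p t <= 1.
  by move=> t0; rewrite /p ge_max ler01 andbT gerBl divr_ge0// ltW.
have pz t : tau <= t -> p t = 0.
  by move=> tt; rewrite /p /pos_part max_r// subr_le0 ler_pdivlMr// mul1r.
pose b (t : R) := p t ^+ 2; pose b' (t : R) := - (2 / tau) * p t.
have cp : continuous p.
  move=> t; apply: (@continuous_cvg _ _ _ _ _ (fun t => 1 - t / tau) pos_part).
    exact: (lip_continuous 1 _ pos_part_lip).
  by apply: cvgB; [exact: cvg_cst|apply: cvgM; [exact: cvg_id|exact: cvg_cst]].
pose c1 t := c t + b t *: v; pose c1' t := c' t + b' t *: v.
have cc1 : C1_curve c1 c1'.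
  split=> [t t01|]; last first.
    apply/subspace_continuousP => t t01; apply: cvgD.
      exact: (@subspace_continuousP _ _ _ _).1 c'c t t01.
    apply: cvgZr_tmp; apply: cvg_within_filter.
    by apply: cvgM; [exact: cvg_cst|exact: cp].
  have FF : Filter (within `[(0 : R), 1]%classic t^') by exact: within_filter.
  have bq : (s - t)^-1 * (b s - b t) @[s --> within `[(0 : R), 1]%classic t^'] --> b' t.
    apply: cvg_within_filter; apply: (cvg_slope_of_sqr_remainder _ _ _ (tau^-1 ^+ 2)) => s.
    have -> : tau^-1 ^+ 2 * (s - t) ^+ 2 = (- (s - t) / tau) ^+ 2.
      by rewrite exprMn sqrrN mulrC.
    have -> : (s - t) * b' t = 2 * (- (s - t) / tau) * p t by rewrite /b'; field.
    rewrite /b /p; have -> : 1 - s / tau = 1 - t / tau + - (s - t) / tau by field.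
    exact: pos_part_sqr_remainder.
  have -> : (fun s : R => (s - t)^-1 *: (c1 s - c1 t)) =
      (fun s => (s - t)^-1 *: (c s - c t) + ((s - t)^-1 * (b s - b t)) *: v).
    by apply/funext => s; rewrite /c1 opprD addrACA -scalerBl scalerDr scalerA.
  by apply: cvgD; [exact: cd|exact: cvgZr_tmp].
exists c1, c1'; split=> //.
- by rewrite /c1 /b /p mul0r subr0 [pos_part 1]max_l ?ler01// expr1n scale1r.
- by rewrite /c1 /b pz// expr0n scale0r addr0.
have intL k k' : C1_curve k k' ->
    (@lebesgue_measure R).-integrable `[(0 : R), 1] (EFin \o (fun t => L (k t) (k' t))).
  move=> kk; apply: continuous_compact_integrable; first exact: segment_compact.
  exact: (finsler_curve_continuous V E LV MV).
have intp : (@lebesgue_measure R).-integrable `[(0 : R), 1] (EFin \o p).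
  apply: continuous_compact_integrable; first exact: segment_compact.
  exact: continuous_subspaceT.
(* Pointwise majorant of the excess length: [C p] for the moved base point and [(2 / tau) S p] for
   the extra velocity. *)
pose g t := (C + 2 / tau * S) * p t.
have intg : (@lebesgue_measure R).-integrable `[(0 : R), 1] (EFin \o g).
  apply: continuous_compact_integrable; first exact: segment_compact.
  apply: continuous_subspaceT => t; apply: cvgM; [exact: cvg_cst|exact: cp].
have Ig : \int[lebesgue_measure]_(t in `[(0 : R), 1]) g t = S + C * tau / 2.
  rewrite /g RintegralZl// Rintegral_pos_part ?tau_gt0//.
  by field.
apply: (@le_trans _ _ (agmon_length V E c c' + (S + C * tau / 2))); last by lra.
rewrite -Ig /agmon_length -RintegralD//; [|exact: intL].
apply: le_Rintegral => //; first exact: intL.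
  by apply: (integrableD _ (intL _ _ cc) intg).
move=> t; rewrite /= in_itv/= => /andP[t0 t1].
have h1 : L (c1 t) (c1' t) <= L (c1 t) (c' t) + `|b' t| * L (c1 t) v.
  apply: le_trans (finsler_triangle _ _ _ _ _) _; rewrite lerD2l; exact: finsler_scale.
have h2 : L (c1 t) (c' t) <= L (c t) (c' t) + C * p t.
  apply: le_trans (finsler_holder V E LV V_lip LV_ge0 _ (c t) _) _; rewrite lerD2l.
  rewrite /c1 [c t + _]addrC addrK normrZ (ger0_norm (sqr_ge0 _)) mulrCA sqrtrM ?sqr_ge0//.
  rewrite sqrtr_sqr (ger0_norm (p0 t)) /C.
  have := M1 t; rewrite t0 t1 => /(_ isT) ct.
  rewrite [_ * M0 * _]mulrAC mulrCA [p t * _]mulrC.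
  by rewrite ler_wpM2l// !mulr_ge0// sqrtr_ge0.
have h3 : `|b' t| * L (c1 t) v <= 2 / tau * S * p t.
  rewrite /b' normrM normrN (ger0_norm (p0 t)) ger0_norm; last by rewrite divr_ge0// ltW.
  rewrite -!mulrA; apply: ler_wpM2l => //; apply: ler_wpM2l; first by rewrite invr_ge0 ltW.
  have [tt|tt] := ltP t tau; last by rewrite pz// !(mul0r, mulr0).
  rewrite mulrC; apply: ler_wpM2r => //; apply: hS.
  rewrite /c1 addrAC; apply: le_trans (ler_normD _ _) _.
  rewrite [`|v| + r]addrC; apply: lerD.
    by apply: htau0 => //; exact: lt_le_trans tt _.
  by rewrite normrZ ler_piMl// ger0_norm ?sqr_ge0// expr_le1// p1.
apply: le_trans h1 _; rewrite /g mulrDl addrA; exact: lerD.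
Qed.

Lemma agmon_length_ge0 c c' : 0 <= agmon_length V E c c'.
Proof. by apply: Rintegral_ge0 => t _; exact: finsler_ge0. Qed.

Let lengths x y := [set l | exists c c' : R -> 'rV[R]_d,
  [/\ C1_curve c c', c 0 = x, c 1 = y & l = agmon_length V E c c']].

Lemma agmon_lengths_has_inf x y : has_inf (lengths x y).
Proof.
split; last by exists 0 => _ [c [c' [_ _ _ ->]]]; exact: agmon_length_ge0.
exists (agmon_length V E (fun t => x + t *: (y - x)) (fun=> y - x)).
exists (fun t => x + t *: (y - x)), (fun=> y - x); split=> //.
- split=> [t _|]; last by apply: continuous_subspaceT => t; exact: cvg_cst.
  have FF : Filter (within `[(0 : R), 1]%classic t^') by exact: within_filter.
  apply: cvg_within_filter; apply/cvgrPdist_le => e e0; near=> s.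
  have s0 : s - t != 0 by rewrite subr_eq0; near: s; exact: nbhs_dnbhs_neq.
  rewrite opprD addrACA subrr add0r -scalerBl scalerA mulVf// scale1r subrr normr0.
  exact: ltW.
- by rewrite scale0r addr0.
- by rewrite scale1r addrC subrK.
Unshelve. all: by end_near. Qed.

Lemma agmon_dist_ge0 x y : 0 <= agmon_dist V E x y.
Proof.
apply: lb_le_inf; first exact: (agmon_lengths_has_inf x y).1.
by move=> _ [c [c' [_ _ _ ->]]]; exact: agmon_length_ge0.
Qed.

Lemma agmon_dist_refl x : agmon_dist V E x x = 0.
Proof.
apply/eqP; rewrite eq_le agmon_dist_ge0 andbT.
apply: le_trans (ge_inf (agmon_lengths_has_inf x x).2 _) _.
  exists (fun=> x), (fun=> 0); split=> //; split=> [t _|].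
    rewrite [X in X @ _ --> _](_ : _ = fun=> 0); first exact: cvg_cst.
    by apply/funext => s; rewrite subrr scaler0.
  by apply: continuous_subspaceT => t; exact: cvg_cst.
rewrite /agmon_length.
have -> : (fun t : R => L x 0) = (fun=> 0).
  apply/funext => _; apply/eqP; rewrite eq_le finsler_ge0 andbT.
  by have := finsler_le_norm V E MV V_bound x 0; rewrite normr0 mulr0.
by rewrite Rintegral_cst// mul0r.
Qed.

Hypothesis G_neq0 : classical_region V E !=set0.

Local Notation dE := (agmon_dist_region V E).

Let dists_has_inf x : has_inf [set agmon_dist V E x y | y in classical_region V E].
Proof.
split; last by exists 0 => _ [y _ <-]; exact: agmon_dist_ge0.
by have [y Gy] := G_neq0; exists (agmon_dist V E x y), y.
Qed.

Lemma dist_region_ge0 x : 0 <= dE x.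
Proof.
by apply: lb_le_inf; [exact: (dists_has_inf x).1|move=> _ [y _ <-]; exact: agmon_dist_ge0].
Qed.

Lemma dist_region_eq0 x : classical_region V E x -> dE x = 0.
Proof.
move=> Gx; apply/eqP; rewrite eq_le dist_region_ge0 andbT -(agmon_dist_refl x).
by apply: ge_inf; [exact: (dists_has_inf x).2|exists x].
Qed.

(* The curve realising [dE x] is deformed near its origin so as to start at
   [x + v], which avoids concatenating (and smoothing) curves. *)
Lemma dist_region_step x v (S r : R) : 0 < r ->
  (forall y, `|y - x| <= `|v| + r -> L y v <= S) -> dE (x + v) <= dE x + S.
Proof.
move=> r0 hS; apply/ler_addgt0Pr => e e0.
have e20 : 0 < e / 3 by rewrite divr_gt0.
have [_ [y Gy <-] hy] := inf_adherent e20 (dists_has_inf x).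
have [_ [c [c' [cc c0 c1 ->]]] hc] := inf_adherent e20 (agmon_lengths_has_inf x y).
have hS' z : `|z - c 0| <= `|v| + r -> L z v <= S by rewrite c0; exact: hS.
have [k [k' [kk k0 k1 hk]]] := perturb_curve c c' v S r (e / 3) cc r0 e20 hS'.
have h1 : dE (x + v) <= agmon_dist V E (x + v) y.
  by apply: ge_inf; [exact: (dists_has_inf _).2|exists y].
have h2 : agmon_dist V E (x + v) y <= agmon_length V E k k'.
  apply: ge_inf; first exact: (agmon_lengths_has_inf _ _).2.
  by exists k, k'; split=> //; [rewrite k0 c0|rewrite k1].
rewrite -/(agmon_dist V E x y) in hc; rewrite -/(dE x) in hy; lra.
Qed.

Lemma dist_region_lip : lip K dE.
Proof.
have step x v : dE (x + v) <= dE x + K * `|v|.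
  by apply: (dist_region_step _ _ _ 1) => // y _; exact: finsler_le_norm.
move=> x y; rewrite ler_norml lerBlDl lerNl opprB lerBlDl.
apply/andP; split.
  by have := step x (y - x); rewrite addrC subrK distrC.
by have := step y (x - y); rewrite addrC subrK.
Qed.

End AgmonDistance.

(** * The weighted estimate on the lattice *)

Section SquareSums.
Context {R : realType} {T : choiceType}.
Implicit Types (a b f : T -> R) (c : R).

Local Notation ssum f := (\esum_(x in [set: T]) (f x)%:E)%E.

Lemma esum_scale_le c f : 0 <= c -> (forall x, 0 <= f x) ->
  (ssum (fun x => (c * f x)%R) <= c%:E * ssum f)%E.
Proof.
move=> c0 f0; apply: ge_ereal_sup => _ [A finA <-].
rewrite fsbig_finite/=; last by case: finA.
under eq_bigr do rewrite EFinM.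
rewrite -ge0_sume_distrr; last by move=> x _; rewrite lee_fin.
apply: lee_wpmul2l; first by rewrite lee_fin.
apply: ereal_sup_ubound; exists A => //.
by rewrite fsbig_finite//; case: finA.
Qed.

Lemma esum_scale_ge c f : 0 < c -> (forall x, 0 <= f x) ->
  (c%:E * ssum f <= ssum (fun x => (c * f x)%R))%E.
Proof.
move=> c0 f0.
have cf x : 0 <= c * f x by rewrite mulr_ge0// ltW.
have c10 : 0 <= c^-1 by rewrite invr_ge0 ltW.
have := esum_scale_le _ _ c10 cf; under eq_esum do rewrite mulKf ?gt_eqF//.
move=> /(lee_wpmul2l (_ : 0 <= c%:E)%E); rewrite lee_fin => /(_ (ltW c0)) h.
by apply: le_trans h _; rewrite muleA -EFinM divff ?gt_eqF// mul1e.
Qed.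

Variables (I : finType) (s : I -> T -> T) (opp : I -> I).
Hypothesis oppK : involutive opp.
Hypothesis s_opp : forall i x, s (opp i) (s i x) = x.

Let s_bij i : set_bij [set: T] [set: T] (s (opp i)).
Proof.
split=> //.
- move=> x y _ _ E; rewrite -[x](s_opp (opp i)) -[y](s_opp (opp i)) oppK.
  by rewrite -[x](s_opp (opp i)) oppK E -{1}[y](s_opp (opp i)) oppK; rewrite -?E ?s_opp.
- by move=> x _; exists (s i x) => //; exact: s_opp.
Qed.

(** Each shift is a bijection with inverse [s (opp i)], so each direction can be reindexed
    separately. *)
Lemma esum_sum_opp (f : I -> T -> R) : (forall i x, 0 <= f i x) ->
  (ssum (fun x => \sum_i f i (s i x))%R = ssum (fun x => \sum_i f (opp i) x)%R).
Proof.
move=> f0.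
under eq_esum do rewrite -sumEFin.
under [RHS]eq_esum do rewrite -sumEFin.
rewrite !esum_sum//; try by move=> x i _ _; rewrite lee_fin.
rewrite [RHS](reindex_inj (inv_inj oppK)); apply: eq_bigr => i _.
rewrite oppK (reindex_esum _ _ _ _ (s_bij i)); apply: eq_esum => x _.
by have := s_opp (opp i) x; rewrite oppK => ->.
Qed.

(* The off-diagonal terms are first bounded by [g (b x ^+ 2 + b (s i x) ^+ 2) / 2];
   summation over [x] then turns the asymmetric weights [W x / W (s i x)] into
   their transposes, which cancel. *)
Lemma weighted_energy_bound (W b N : T -> R) (c G : R) :
  (forall x, 0 < W x) -> 0 < c -> (forall x, 0 <= b x) -> (forall x, 0 <= N x) ->
  (forall i x, W (s i x) / W x <= G) ->
  (ssum (fun x => b x ^+ 2)%R < +oo)%E ->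
  (forall x, b x ^+ 2 * (\sum_i W (s i x) / W x / 2 + c) <=
     b x * N x + \sum_i W x / W (s i x) / 2 * b (s i x) ^+ 2) ->
  (ssum (fun x => c / 2 * b x ^+ 2)%R <= ssum (fun x => N x ^+ 2 / (2 * c))%R)%E.
Proof.
move=> W0 c0 b0 N0 WG bfin hb.
have r0 x y : 0 <= W x / W y by rewrite divr_ge0 ?ltW.
pose X x := \sum_i W (s i x) / W x / 2 * b x ^+ 2.
pose Y x := \sum_i W x / W (s i x) / 2 * b (s i x) ^+ 2.
have X0 x : 0 <= X x by apply: sumr_ge0 => i _; rewrite mulr_ge0 ?sqr_ge0// mulr_ge0.
have Y0 x : 0 <= Y x by apply: sumr_ge0 => i _; rewrite mulr_ge0 ?sqr_ge0// mulr_ge0.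
have XY : ssum X = ssum Y.
  pose f i x := W (s (opp i) x) / W x / 2 * b x ^+ 2.
  have f0 i x : 0 <= f i x by rewrite mulr_ge0 ?sqr_ge0// mulr_ge0.
  transitivity (ssum (fun x => \sum_i f (opp i) x)%R).
    by apply: eq_esum => x _; congr (_ %:E); apply: eq_bigr => i _; rewrite /f oppK.
  rewrite -(esum_sum_opp f f0).
  by apply: eq_esum => x _; congr (_ %:E); apply: eq_bigr => i _; rewrite /f s_opp.
(* The symmetrised sum is cancelled from both sides at the end, which in the extended reals requires
   it to be finite; the ratio bound [G] and summability of [b] give this. *)
have Xfin : (ssum X < +oo)%E.
  have G0 : 0 <= `|G| * #|I|%:R by rewrite mulr_ge0.
  apply: le_lt_trans (_ : (`|G| * #|I|%:R)%:E * ssum (fun x => (b x ^+ 2)%R) < +oo)%E.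
    apply: le_trans (esum_scale_le _ _ G0 (fun x => sqr_ge0 _)).
    apply: le_esum => x _; rewrite lee_fin /X -mulr_suml ler_wpM2r ?sqr_ge0//.
    rewrite mulr_natr -sumr_const; apply: ler_sum => i _.
    apply: le_trans (_ : W (s i x) / W x <= _); first by have := r0 (s i x) x; lra.
    exact: le_trans (WG i x) (ler_norm _).
  have [S0 SE] : exists r : R, ssum (fun x => (b x ^+ 2)%R) = r%:E.
    have : (ssum (fun x => (b x ^+ 2)%R) \is a fin_num).
      by rewrite ge0_fin_numE// esum_ge0// => x _; rewrite lee_fin sqr_ge0.
    by move=> /fineK <-; eexists.
  by rewrite SE -EFinM ltry.
have pw x : X x + c / 2 * b x ^+ 2 <= N x ^+ 2 / (2 * c) + Y x.
  have := hb x; rewrite -/(Y x) mulrDr mulr_sumr.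
  have -> : \sum_i b x ^+ 2 * (W (s i x) / W x / 2) = X x.
    by apply: eq_bigr => i _; rewrite mulrC.
  have : b x * N x <= c / 2 * b x ^+ 2 + N x ^+ 2 / (2 * c).
    rewrite -subr_ge0.
    have -> : c / 2 * b x ^+ 2 + N x ^+ 2 / (2 * c) - b x * N x =
       (c * b x - N x) ^+ 2 / (2 * c) by field; rewrite gt_eqF.
    by rewrite divr_ge0 ?sqr_ge0// mulr_ge0// ltW.
  lra.
have : (ssum X + ssum (fun x => (c / 2 * b x ^+ 2)%R) <=
        ssum X + ssum (fun x => (N x ^+ 2 / (2 * c))%R))%E.
  rewrite {2}XY [leRHS]addeC -!esumD.
  - by apply: le_esum => x _; rewrite -!EFinD lee_fin.
  - by move=> x _; rewrite lee_fin divr_ge0 ?sqr_ge0// mulr_ge0// ltW.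
  - by move=> x _; rewrite lee_fin.
  - by move=> x _; rewrite lee_fin.
  - by move=> x _; rewrite lee_fin mulr_ge0 ?sqr_ge0// divr_ge0// ltW.
rewrite leeD2lE// ge0_fin_numE//.
by apply: esum_ge0 => x _; rewrite lee_fin.
Qed.

End SquareSums.

(** * Nearest neighbours on the lattice *)

Section LatticeShift.
Context {R : realType} {d : nat} {h : R}.
Hypothesis h_gt0 : 0 < h.
Local Notation direction := ('I_d * bool)%type.
Local Notation site := (lattice d h).
Implicit Types (x y : site) (i : direction).

Definition unit_dir i : 'rV[R]_d := (if i.2 then 1 else -1) *: delta_mx 0 i.1.

Definition opp_dir i : direction := (i.1, ~~ i.2).

Lemma opp_dirK : involutive opp_dir.
Proof. by case=> j b; rewrite /opp_dir negbK. Qed.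

Lemma unit_dir_opp i : unit_dir (opp_dir i) = - unit_dir i.
Proof. by case: i => j [] /=; rewrite /unit_dir /= ?scaleN1r ?scale1r ?opprK. Qed.

Let int_dir i : 'rV[int]_d := (if i.2 then 1 else -1) *: delta_mx 0 i.1.

Let int_dirE i : map_mx intr (int_dir i) = unit_dir i.
Proof.
case: i => j b; apply/rowP => k; rewrite !mxE eqxx /=.
by case: b; case: (k == j); rewrite ?mulr1 ?mulr0.
Qed.

Lemma lattice_shift_proof i x : lattice d h (val x + h *: unit_dir i).
Proof.
have [m _ mE] := set_valP x; exists (m + int_dir i) => //.
by rewrite -mE map_mxD int_dirE scalerDr.
Qed.

Definition lattice_shift i x : site :=
  exist (fun z => z \in lattice d h) _ (mem_set (lattice_shift_proof i x)).

Lemma lattice_shiftE i x : val (lattice_shift i x) = val x + h *: unit_dir i.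
Proof. by []. Qed.

Lemma lattice_shift_opp i x : lattice_shift (opp_dir i) (lattice_shift i x) = x.
Proof.
by apply: val_inj; rewrite !lattice_shiftE unit_dir_opp scalerN addrK.
Qed.

Lemma unit_dir_inj : injective unit_dir.
Proof.
move=> [j b] [k c] /rowP /(_ j); rewrite !mxE !eqxx /= mulr1.
case: (eqVneq j k) => [->|_]; last first.
  by rewrite mulr0 => E; case: b E => /eqP; rewrite ?oppr_eq0 oner_eq0.
rewrite mulr1; case: b; case: c => // /eqP.
  by rewrite -subr_eq0 opprK -(natrD _ 1 1) pnatr_eq0.
by rewrite -subr_eq0 -opprD oppr_eq0 -(natrD _ 1 1) pnatr_eq0.
Qed.

Lemma unit_dir_norm i : `|unit_dir i| <= 1.
Proof.
rewrite /unit_dir; apply: le_trans (norm_scale_delta_le _ _) _.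
by case: i.2; rewrite ?normrN normr1.
Qed.

(** A nonzero integer has square at least 1, so one entry uses up the whole sum and the others
    vanish. *)
Lemma int_unit_vector (m : 'rV[int]_d) : \sum_j m 0 j ^+ 2 = 1 ->
  exists i, m = int_dir i.
Proof.
move=> m1.
have [j mj] : exists j, m 0 j != 0.
  apply: contrapT => /forallNP mz; move: m1; rewrite big1// => j _.
  by have /negP := mz j; rewrite negbK => /eqP ->; rewrite expr0n.
move: m1; rewrite (bigD1 j)//=; set S := \sum_(_ | _) _ => m1.
have S0 : 0 <= S by apply: sumr_ge0 => k _; exact: sqr_ge0.
have mj1 : 1 <= m 0 j ^+ 2 by rewrite -gtz0_ge1 exprn_even_gt0.
have [Sz mjE] : S = 0 /\ m 0 j ^+ 2 = 1.
  by move: (m 0 j ^+ 2) (S) mj1 S0 m1 => a b; lia.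
have mk k : k != j -> m 0 k = 0.
  move=> kj; move: Sz => /eqP; rewrite psumr_eq0; last by move=> ? _; exact: sqr_ge0.
  by move/allP => /(_ k (mem_index_enum k)); rewrite kj /= sqrf_eq0 => /eqP.
exists (j, m 0 j == 1); apply/rowP => k; rewrite !mxE eqxx /=.
have [->|kj] := eqVneq k j; last by rewrite mulr0 mk.
rewrite mulr1; move/eqP: mjE; rewrite sqrf_eq1 => /orP[|] /eqP -> //.
Qed.

Lemma eucl_norm_int (m : 'rV[int]_d) :
  eucl_norm (h *: map_mx intr m : 'rV[R]_d) = h <-> \sum_j m 0 j ^+ 2 = 1.
Proof.
have -> : eucl_norm (h *: map_mx intr m : 'rV[R]_d) = h * Num.sqrt (\sum_j m 0 j ^+ 2)%:~R.
  rewrite /eucl_norm eucl_dotZl eucl_dotZr mulrA -expr2 sqrtrM ?sqr_ge0// sqrtr_sqr gtr0_norm//.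
  congr (_ * Num.sqrt _); rewrite /eucl_dot raddf_sum; apply: eq_bigr => j _.
  by rewrite !mxE expr2 -intrM.
set S := \sum_j _; have S0 : 0 <= S by apply: sumr_ge0 => j _; exact: sqr_ge0.
split=> [E|->]; last by rewrite sqrtr1 mulr1.
have E1 : Num.sqrt (S%:~R : R) = 1.
  by apply: (mulfI (lt0r_neq0 h_gt0)); rewrite E mulr1.
have : (S%:~R : R) = 1%:~R by rewrite -[LHS]sqr_sqrtr ?ler0z// E1 expr1n.
by move/eqP; rewrite eqr_int => /eqP.
Qed.

Lemma neighbourE x y : eucl_norm (val x - val y) = h <-> exists i, y = lattice_shift i x.
Proof.
split=> [|[i ->]]; last first.
  rewrite lattice_shiftE opprD addrA subrr add0r -scalerN -unit_dir_opp -int_dirE.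
  apply/eucl_norm_int; rewrite (bigD1 i.1)//= big1 ?addr0.
    by rewrite !mxE !eqxx /= mulr1; case: i.2.
  by move=> k /negbTE ki; rewrite !mxE ki andbF mulr0 expr0n.
have [mx _ mxE] := set_valP x; have [my _ myE] := set_valP y.
have xyE : val x - val y = h *: map_mx intr (mx - my).
  by rewrite -mxE -myE -scalerBr map_mxB.
rewrite xyE => /eucl_norm_int /int_unit_vector [i iE].
exists (opp_dir i); apply: val_inj; rewrite lattice_shiftE unit_dir_opp -int_dirE -iE.
by rewrite scalerN -xyE opprB addrC subrK.
Qed.

(** For [h > 0] the directions give pairwise distinct neighbours and exhaust them, so the sum over a
    set becomes a sum over a finite type. *)
Lemma schrodingerE V u x : schrodinger V u x =
  - (\sum_i (u (lattice_shift i x) - u x)) + (V (val x))%:C%C * u x.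
Proof.
rewrite /schrodinger; congr (- _ + _).
set A := [set _ | _]; have AE i : A (lattice_shift i x) := (neighbourE x _).2 (ex_intro _ i erefl).
rewrite (fsbigE [seq lattice_shift i x | i <- index_enum _]).
- by rewrite big_map; apply: eq_bigl => i; rewrite (mem_set (AE i)).
- rewrite map_inj_uniq ?index_enum_uniq// => i j /(congr1 val).
  rewrite !lattice_shiftE => /addrI /(scalerI (lt0r_neq0 h_gt0)); exact: unit_dir_inj.
- by move=> y /mapP[i _ ->]; exact: AE.
- move=> y yA /negP; case; have [i ->] := (neighbourE x y).1 yA.
  by apply: map_f; exact: mem_index_enum.
Qed.

End LatticeShift.

Section ComplexNorm.
Context {R : realType}.
Local Notation norm := (@Normc.normc R).

Lemma normc_ge0 (w : R[i]) : 0 <= norm w.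
Proof. by case: w => a b; exact: sqrtr_ge0. Qed.

Lemma normc_real (a : R) : norm (a%:C)%C = `|a|.
Proof. by rewrite /= expr0n addr0 sqrtr_sqr. Qed.

Lemma normc_sum (I : finType) (f : I -> R[i]) : norm (\sum_i f i) <= \sum_i norm (f i).
Proof.
apply: (big_ind2 (fun (w : R[i]) (a : R) => norm w <= a)) => //.
  by rewrite Normc.normc0.
by move=> w a w' b wa wb; apply: le_trans (le_normcD w w') _; exact: lerD.
Qed.

(** Reduces the complex spectral parameter to its real part once moduli are taken. *)
Lemma le_normc_sub (D : R) (z : R[i]) : D - complex.Re z <= norm ((D%:C)%C - z).
Proof.
case: z => a b /=; apply: le_trans (ler_norm _) _; rewrite -sqrtr_sqr ler_wsqrtr//.
by rewrite lerDl sqr_ge0.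
Qed.

End ComplexNorm.

(** * Effect of truncating the weight *)

Section Truncation.
Context {R : realType}.
Implicit Types (a b k s t : R).

(** Truncation shrinks increments of the weight; by this monotonicity the gap for [rho] also serves
    for [min rho k]. *)
Lemma sinh_half_sqr_mono s t : `|s| <= `|t| -> sinh (s / 2) ^+ 2 <= sinh (t / 2) ^+ 2.
Proof.
have even u : sinh (u / 2) ^+ 2 = sinh (`|u| / 2) ^+ 2 :> R.
  have [u0|u0] := leP 0 u; first by rewrite ger0_norm.
  by rewrite ltr0_norm// !sinh_half_sqr opprK [expR u + _]addrC.
rewrite (even s) (even t); move: `|s| (normr_ge0 s) `|t| => {}s s0 {}t st.
apply: le_trans (sinh_half_sqr_tangent t s); rewrite lerDl mulr_ge0 ?subr_ge0//.
rewrite divr_ge0// subr_ge0 ler_expR; lra.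
Qed.

Lemma minr_dist_le a b k : `|Num.min a k - Num.min b k| <= `|a - b|.
Proof.
have h1 := ler_norm (a - b); have h2 := ler_norm (b - a); rewrite distrC in h2.
rewrite ler_norml.
by case: (leP a k) => ?; case: (leP b k) => ?; apply/andP; split; lra.
Qed.

Lemma sqr_sum_le (I : finType) (m : I -> R) :
  (\sum_i m i) ^+ 2 <= #|I|%:R * \sum_i m i ^+ 2.
Proof.
rewrite expr2 mulr_suml.
under eq_bigr do rewrite mulr_sumr.
apply: le_trans (_ : \sum_i \sum_j (m i ^+ 2 / 2 + m j ^+ 2 / 2) <= _).
  apply: ler_sum => i _; apply: ler_sum => j _.
  have := sqr_ge0 (m i - m j); rewrite !expr2; nra.
rewrite le_eqVlt; apply/orP; left; apply/eqP.
have -> : \sum_i \sum_j (m i ^+ 2 / 2 + m j ^+ 2 / 2) =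
    \sum_i (#|I|%:R * (m i ^+ 2 / 2) + (\sum_j m j ^+ 2) / 2).
  apply: eq_bigr => i _.
  by rewrite big_split /= sumr_const -[X in X + _]mulr_natl -mulr_suml.
rewrite big_split /= sumr_const -mulr_sumr -mulr_suml -[X in _ + X]mulr_natl.
by rewrite -mulrDr -splitr.
Qed.

End Truncation.

(** * The estimate for an abstract weight with a spectral gap *)

Section LatticeEstimate.
Context {R : realType} {d : nat} {h : R}.
Hypothesis h_gt0 : 0 < h.
Local Notation direction := ('I_d * bool)%type.
Local Notation site := (lattice d h).
Local Notation norm := (@Normc.normc R).
Local Notation n := (#|{: 'I_d * bool}|%:R : R).
Variables (V rho chi chit : 'rV[R]_d -> R) (Lr c : R) (z : R[i]) (u : site -> R[i]).
Hypotheses (rho_ge0 : forall x, 0 <= rho x) (rho_lip : lip Lr rho).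
Hypotheses (chi01 : forall x, 0 <= chi x <= 1) (chit01 : forall x, 0 <= chit x <= 1).
Hypotheses (c_gt0 : 0 < c) (u_ell2 : ell2 u).
(** Since [2 sinh^2 (t / 2) = cosh t - 1], the sum is the cost of conjugating the hopping terms by
    the weight. *)
Hypothesis gap : forall x, chi x != 0 ->
  c + \sum_(i : direction) 2 * sinh ((rho (x + h *: unit_dir i) - rho x) / h / 2) ^+ 2
    <= V x - complex.Re z.
(** The commutator with [chi] is supported where the weight equals 1, so it is controlled by
    [chit u] with no exponential. *)
Hypothesis transition : forall x (i : direction), chi (x + h *: unit_dir i) != chi x ->
  rho x = 0 /\ chit (x + h *: unit_dir i) = 1.

Let Pu (x : site) : R[i] := schrodinger V u x - z * u x.
Let F (k : R) (x : site) : R :=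
  chi (val x) * expR (Num.min (rho (val x)) k / h) * norm (Pu x).
Let b (k : R) (x : site) : R :=
  chi (val x) * expR (Num.min (rho (val x)) k / h) * norm (u x).
Let mt (x : site) : R := chit (val x) * norm (u x).

Let chi_ge0 x : 0 <= chi x. Proof. by have /andP[] := chi01 x. Qed.
Let b_ge0 k x : 0 <= b k x.
Proof. by rewrite !mulr_ge0 ?expR_ge0 ?normc_ge0. Qed.
Let F_ge0 k x : 0 <= F k x.
Proof. by rewrite !mulr_ge0 ?expR_ge0 ?normc_ge0. Qed.
Let mt_ge0 x : 0 <= mt x.
Proof. by rewrite mulr_ge0 ?normc_ge0//; have /andP[] := chit01 (val x). Qed.

Let W k (x : site) : R := expR (Num.min (rho (val x)) k / h).
Let W_gt0 k x : 0 < W k x. Proof. exact: expR_gt0. Qed.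

(** The first sum is the conjugated hopping, the second the commutator of the hopping with [chi]. *)
Let conjugated_identity k (x : site) :
  ((n + V (val x))%:C%C - z) * ((chi (val x) * W k x)%:C%C * u x) =
  (chi (val x) * W k x)%:C%C * Pu x +
  \sum_(i : direction) (W k x / W k (lattice_shift i x))%:C%C *
     ((chi (val (lattice_shift i x)) * W k (lattice_shift i x))%:C%C * u (lattice_shift i x)) +
  \sum_(i : direction) (W k x * (chi (val x) - chi (val (lattice_shift i x))))%:C%C *
     u (lattice_shift i x).
Proof.
rewrite /Pu schrodingerE// -addrA -big_split /=.
have -> : \sum_(i : direction) ((W k x / W k (lattice_shift i x))%:C%C *
     ((chi (val (lattice_shift i x)) * W k (lattice_shift i x))%:C%C * u (lattice_shift i x)) +
     (W k x * (chi (val x) - chi (val (lattice_shift i x))))%:C%C * u (lattice_shift i x)) =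
   (chi (val x) * W k x)%:C%C * \sum_(i : direction) u (lattice_shift i x).
  rewrite mulr_sumr; apply: eq_bigr => i _; rewrite mulrA -mulrDl -rmorphM -rmorphD /=.
  congr ((_)%:C%C * _); field; exact: lt0r_neq0.
rewrite sumrB sumr_const rmorphD rmorph_nat -[u x *+ _]mulr_natl.
ring.
Qed.

(** Moduli in the identity. A commutator term is nonzero only if [rho x = 0]; then [W k x = 1]
    because [k >= 0], and [chit] is 1 at the neighbour. *)
Let pointwise_bound k (x : site) : 0 <= k ->
  (n + V (val x) - complex.Re z) * b k x <=
  F k x + \sum_(i : direction) W k x / W k (lattice_shift i x) * b k (lattice_shift i x)
    + \sum_(i : direction) mt (lattice_shift i x).
Proof.
move=> k0.
have nr (a : R) w : 0 <= a -> norm (a%:C%C * w) = a * norm w.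
  by move=> a0; rewrite Normc.normcM normc_real ger0_norm.
have a0 y : 0 <= chi (val y) * W k y by rewrite mulr_ge0// ltW.
have r0 y y' : 0 <= W k y / W k y' by rewrite divr_ge0// ltW.
apply: le_trans (_ : norm (((n + V (val x))%:C%C - z) * ((chi (val x) * W k x)%:C%C * u x)) <= _).
  by rewrite Normc.normcM nr// ler_wpM2r ?b_ge0// le_normc_sub.
rewrite conjugated_identity.
apply: le_trans (le_normcD _ _) _; apply: lerD.
  apply: le_trans (le_normcD _ _) _; apply: lerD; first by rewrite nr.
  apply: le_trans (normc_sum _ _) _; apply: ler_sum => i _.
  by rewrite nr// nr.
apply: le_trans (normc_sum _ _) _; apply: ler_sum => i _.
rewrite Normc.normcM normc_real ler_wpM2r ?normc_ge0//.
rewrite lattice_shiftE; have [->|neq] := eqVneq (chi (val x + h *: unit_dir i)) (chi (val x)).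
  by rewrite subrr mulr0 normr0; have /andP[] := chit01 (val x + h *: unit_dir i).
have [rx ->] := transition _ _ neq.
rewrite /W rx min_l// mul0r expR0 mul1r ler_norml.
have /andP[? ?] := chi01 (val x); have /andP[? ?] := chi01 (val x + h *: unit_dir i).
by apply/andP; split; lra.
Qed.

Let energy_ineq k (x : site) : 0 <= k ->
  b k x ^+ 2 * (\sum_(i : direction) W k (lattice_shift i x) / W k x / 2 + c) <=
  b k x * (F k x + \sum_(i : direction) mt (lattice_shift i x)) +
  \sum_(i : direction) W k x / W k (lattice_shift i x) / 2 * b k (lattice_shift i x) ^+ 2.
Proof.
move=> k0.
have r0 y y' : 0 <= W k y / W k y' by rewrite divr_ge0// ltW.
have M0 : 0 <= \sum_(i : direction) mt (lattice_shift i x) by apply: sumr_ge0.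
have S0 : 0 <= \sum_(i : direction) W k x / W k (lattice_shift i x) / 2 *
    b k (lattice_shift i x) ^+ 2.
  by apply: sumr_ge0 => i _; rewrite mulr_ge0 ?sqr_ge0// divr_ge0.
(* The gap is available only where [chi] is nonzero; elsewhere [b k x = 0] and the left side
   vanishes. *)
have [bz|bn] := eqVneq (b k x) 0.
  by rewrite bz expr0n mul0r mul0r add0r.
have chin : chi (val x) != 0 by apply: contraNneq bn => cz; rewrite /b cz !mul0r.
have g := gap _ chin.
(* With [t] the truncated increment divided by [h], the left side is [cosh t]; summing the 1 over
   all directions restores the diagonal term [n]. *)
have hyp i : W k x / W k (lattice_shift i x) / 2 + W k (lattice_shift i x) / W k x / 2 <=
    2 * sinh ((rho (val x + h *: unit_dir i) - rho (val x)) / h / 2) ^+ 2 + 1.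
  pose t := (Num.min (rho (val x + h *: unit_dir i)) k - Num.min (rho (val x)) k) / h.
  have -> : W k x / W k (lattice_shift i x) = expR (- t).
    by rewrite /W -expRN -expRD lattice_shiftE; congr expR; rewrite /t; ring.
  have -> : W k (lattice_shift i x) / W k x = expR t.
    by rewrite /W -expRN -expRD lattice_shiftE; congr expR; rewrite /t; ring.
  apply: le_trans (_ : 2 * sinh (t / 2) ^+ 2 + 1 <= _).
    by rewrite sinh_half_sqr; lra.
  rewrite lerD2r ler_wpM2l// sinh_half_sqr_mono// !normrM ler_wpM2r//.
  exact: minr_dist_le.
have hs : \sum_(i : direction) W k x / W k (lattice_shift i x) / 2 +
    \sum_(i : direction) W k (lattice_shift i x) / W k x / 2 + c <=
    n + V (val x) - complex.Re z.
  rewrite -big_split /=; apply: le_trans (_ : \sum_(i : direction)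
    (2 * sinh ((rho (val x + h *: unit_dir i) - rho (val x)) / h / 2) ^+ 2 + 1) + c <= _).
    by rewrite lerD2r; apply: ler_sum => i _; exact: hyp.
  rewrite big_split /= sumr_const; lra.
have pw := ler_wpM2l (b_ge0 k x) (pointwise_bound k x k0).
have amgm : b k x * (\sum_(i : direction) W k x / W k (lattice_shift i x) * b k (lattice_shift i x))
   <= b k x ^+ 2 * (\sum_(i : direction) W k x / W k (lattice_shift i x) / 2) +
   \sum_(i : direction) W k x / W k (lattice_shift i x) / 2 * b k (lattice_shift i x) ^+ 2.
  rewrite !mulr_sumr -big_split /=; apply: ler_sum => i _.
  move: (W k x / _) (r0 x (lattice_shift i x)) (b k x) (b k (lattice_shift i x)) => g0 g00 y y'.
  have := mulr_ge0 g00 (sqr_ge0 (y - y')); rewrite !expr2; nra.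
have hs' := ler_wpM2l (sqr_ge0 (b k x)) hs.
move: (b k x) (F k x) (n + V (val x) - complex.Re z) pw hs' amgm => B Q D.
move: (\sum_i mt _) (\sum_i W k x / W k _ * _) (\sum_i W k x / W k _ / 2)
  (\sum_i W k _ / W k x / 2) (\sum_i W k x / W k _ / 2 * _) => M G A1 A2 Y pw hs' amgm.
have : B ^+ 2 * (A1 + A2 + c) <= B * (Q + G + M).
  by apply: le_trans hs' _; rewrite expr2 -mulrA [B * D]mulrC.
rewrite !mulrDr; lra.
Qed.

Hypothesis Lr_ge0 : 0 <= Lr.

Local Notation ssum f := (\esum_(x in [set: site]) (f x)%:E)%E.

Let Fw (x : site) : R := chi (val x) * expR (rho (val x) / h) * norm (Pu x).
Let bw (x : site) : R := chi (val x) * expR (rho (val x) / h) * norm (u x).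

Let ssum_ge0 (f : site -> R) : (forall x, 0 <= f x) -> (0 <= ssum f)%E.
Proof. by move=> f0; apply: esum_ge0 => x _; rewrite lee_fin. Qed.

Let u_fin : (ssum (fun x => norm (u x) ^+ 2)%R < +oo)%E.
Proof.
have := u_ell2; rewrite /ell2 /l2norm -!ge0_fin_numE ?sqrte_ge0 ?sqrte_fin_num//.
all: by apply: ssum_ge0 => x; exact: sqr_ge0.
Qed.

Let b_fin k : (ssum (fun x => b k x ^+ 2)%R < +oo)%E.
Proof.
have e0 : 0 <= expR (k / h) ^+ 2 by rewrite sqr_ge0.
apply: le_lt_trans (_ : (expR (k / h) ^+ 2)%:E * ssum (fun x => norm (u x) ^+ 2)%R < +oo)%E.
  apply: le_trans (esum_scale_le _ _ e0 (fun x => sqr_ge0 _)).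
  apply: le_esum => x _; rewrite lee_fin -exprMn ler_pXn2r ?nnegrE ?mulr_ge0 ?expR_ge0 ?normc_ge0//.
  rewrite ler_wpM2r ?normc_ge0// -[leRHS]mul1r ler_pM ?expR_ge0//.
    by have /andP[] := chi01 (val x).
  by rewrite ler_expR ler_pM2r ?invr_gt0// ge_min lexx orbT.
have : (ssum (fun x => (norm (u x) ^+ 2)%R) \is a fin_num).
  by rewrite ge0_fin_numE//; apply: ssum_ge0 => x; exact: sqr_ge0.
by move=> /fineK <-; rewrite -EFinM ltry.
Qed.

Let W_ratio k i x : W k (lattice_shift i x) / W k x <= expR Lr.
Proof.
rewrite /W -expRN -expRD lattice_shiftE ler_expR -mulrBl ler_pdivrMr//.
apply: le_trans (ler_norm _) _; apply: le_trans (minr_dist_le _ _ _) _.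
apply: le_trans (rho_lip _ _) _; rewrite [val x + _]addrC addrK ler_wpM2l//.
by rewrite normrZ gtr0_norm// ler_piMr ?(ltW h_gt0)// unit_dir_norm.
Qed.

(** [2 / c] comes from absorbing into the gap and [1 + n] from summing over the [n] neighbours. *)
Definition lattice_const : R := 2 / c * (1 + n).

(** The right side carries the full weight, so the bound is uniform in [k] and the truncation can be
    removed. *)
Let truncated_bound k : 0 <= k ->
  (ssum (fun x => b k x ^+ 2)%R <=
   (lattice_const ^+ 2)%:E * (ssum (fun x => Fw x ^+ 2)%R + ssum (fun x => mt x ^+ 2)%R))%E.
Proof.
move=> k0; set SF := ssum (fun x => Fw x ^+ 2)%R; set St := ssum (fun x => mt x ^+ 2)%R.
have n0 : 0 <= n by [].
have SF0 : (0 <= SF)%E by apply: ssum_ge0 => x; exact: sqr_ge0.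
have St0 : (0 <= St)%E by apply: ssum_ge0 => x; exact: sqr_ge0.
have N0 x : 0 <= F k x + \sum_(i : direction) mt (lattice_shift i x).
  by rewrite addr_ge0//; apply: sumr_ge0.
have H := weighted_energy_bound _ lattice_shift opp_dir opp_dirK lattice_shift_opp
  (W k) (b k) _ c (expR Lr)
  (W_gt0 k) c_gt0 (b_ge0 k) N0 (W_ratio k) (b_fin k) (fun x => energy_ineq k x k0).
have c20 : 0 < c / 2 by rewrite divr_gt0.
have Fk x : F k x <= Fw x.
  rewrite ler_wpM2r ?normc_ge0// ler_wpM2l// ler_expR ler_pM2r ?invr_gt0//.
  by rewrite ge_min lexx.
rewrite -(@lee_pmul2l _ (c / 2)%:E)//.
apply: le_trans (esum_scale_ge _ _ c20 (fun x => sqr_ge0 _)) _.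
apply: le_trans H _.
pose f (i : direction) x := n / c * mt x ^+ 2.
have f0 i x : 0 <= f i x by rewrite mulr_ge0 ?sqr_ge0// divr_ge0// ltW.
have ci0 : 0 <= c^-1 by rewrite invr_ge0 ltW.
apply: le_trans (_ : ssum (fun x => c^-1 * Fw x ^+ 2)%R +
    ssum (fun x => \sum_i f i (lattice_shift i x))%R <= _)%E.
  rewrite -esumD; last 2 first.
  - by move=> x _; rewrite lee_fin mulr_ge0 ?sqr_ge0.
  - by move=> x _; rewrite lee_fin; apply: sumr_ge0.
  apply: le_esum => x _; rewrite -EFinD lee_fin /f -mulr_sumr.
  have h1 := sqr_sum_le _ (fun i : direction => mt (lattice_shift i x)).
  have h2 : F k x ^+ 2 <= Fw x ^+ 2 by rewrite ler_pXn2r ?nnegrE// (le_trans (F_ge0 k x)).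
  rewrite ler_pdivrMr ?mulr_gt0//.
  move: (\sum_i mt _) h1 => M h1.
  set S := \sum_i _ in h1 *; move: (F k x) (Fw x ^+ 2) h2 => g G h2.
  have -> : (c^-1 * G + n / c * S) * (2 * c) = 2 * (G + n * S) by field; rewrite gt_eqF.
  have := sqr_ge0 (g - M); rewrite !expr2 in h1 h2 *; nra.
rewrite (esum_sum_opp _ lattice_shift opp_dir opp_dirK lattice_shift_opp f f0).
have -> : ssum (fun x => \sum_i f (opp_dir i) x)%R = ssum (fun x => n * (n / c) * mt x ^+ 2)%R.
  by apply: eq_esum => x _; congr (_ %:E); rewrite /f sumr_const -[LHS]mulr_natl mulrA.
have nc0 : 0 <= n * (n / c) by rewrite mulr_ge0// divr_ge0// ltW.
apply: le_trans (leeD (esum_scale_le _ _ ci0 (fun x => sqr_ge0 _))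
  (esum_scale_le _ _ nc0 (fun x => sqr_ge0 _))) _.
rewrite muleA -EFinM ge0_muleDr// -/SF -/St.
have -> : c / 2 * lattice_const ^+ 2 = 2 * (1 + n) ^+ 2 * c^-1.
  by rewrite /lattice_const; field; rewrite gt_eqF.
have n1 : 1 <= (1 + n) ^+ 2 by rewrite expr_ge1// lerDl.
apply: leeD; apply: lee_wpmul2r => //; rewrite lee_fin.
  by rewrite ler_peMl//; lra.
rewrite mulrA ler_wpM2r// expr2; have := mulr_ge0 n0 n0; lra.
Qed.

Lemma lattice_agmon_estimate :
  (l2norm (fmul (fun x => chi x * expR (rho x / h))%R u) <=
   lattice_const%:E * l2norm (fmul chit u) +
   lattice_const%:E * l2norm (fmul (fun x => chi x * expR (rho x / h))%R
                              (fun x => schrodinger V u x - z * u x)%R))%E.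
Proof.
have nr (a : R) w : 0 <= a -> norm (a%:C%C * w) = a * norm w.
  by move=> a0; rewrite Normc.normcM normc_real ger0_norm.
have w0 (x : site) : 0 <= chi (val x) * expR (rho (val x) / h) by rewrite mulr_ge0// expR_ge0.
have t0 (x : site) : 0 <= chit (val x) by have /andP[] := chit01 (val x).
have -> : l2norm (fmul (fun x => chi x * expR (rho x / h))%R u) =
    sqrte (ssum (fun x => bw x ^+ 2)%R).
  by congr sqrte; apply: eq_esum => x _; rewrite /fmul nr.
have -> : l2norm (fmul chit u) = sqrte (ssum (fun x => mt x ^+ 2)%R).
  by congr sqrte; apply: eq_esum => x _; rewrite /fmul nr.
have -> : l2norm (fmul (fun x => chi x * expR (rho x / h))%R
    (fun x => schrodinger V u x - z * u x)%R) = sqrte (ssum (fun x => Fw x ^+ 2)%R).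
  by congr sqrte; apply: eq_esum => x _; rewrite /fmul nr.
set SF := ssum (fun x => Fw x ^+ 2)%R; set St := ssum (fun x => mt x ^+ 2)%R.
have SF0 : (0 <= SF)%E by apply: ssum_ge0 => x; exact: sqr_ge0.
have St0 : (0 <= St)%E by apply: ssum_ge0 => x; exact: sqr_ge0.
have C0 : 0 < lattice_const by rewrite mulr_gt0 ?divr_gt0// ltr_pwDl.
have bound : (ssum (fun x => bw x ^+ 2)%R <= (lattice_const ^+ 2)%:E * (SF + St))%E.
  apply: ge_ereal_sup => _ [A finA <-].
  rewrite fsbig_finite/=; last by case: finA.
  set r := finmap.enum_fset _.
  (* The infinite sum is a supremum over finite sets. On a finite set this level exceeds every value
     of [rho], so truncation changes nothing there. *)
  pose k := \sum_(x <- r) rho (val x).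
  have k0 : 0 <= k by apply: sumr_ge0.
  have rk x : x \in r -> rho (val x) <= k.
    by move=> xr; rewrite /k (big_rem x)//= lerDl sumr_ge0.
  apply: le_trans (truncated_bound k k0).
  apply: esum_ge; exists A => //; rewrite fsbig_finite/=; last by case: finA.
  rewrite -/r le_eqVlt; apply/orP; left; apply/eqP.
  by apply: eq_big_seq => x xr; rewrite /bw /b min_l// rk.
apply: (@le_trans _ _ (sqrte ((lattice_const ^+ 2)%:E * (SF + St)))%E).
  by rewrite lee_sqrt// mule_ge0 ?adde_ge0// lee_fin sqr_ge0.
rewrite sqrteM ?lee_fin ?sqr_ge0//= sqrtr_sqr gtr0_norm//.
rewrite -ge0_muleDr ?sqrte_ge0//; apply: lee_wpmul2l; first by rewrite lee_fin ltW.
move: SF St SF0 St0 {bound} => [SF| |] [St| |] //= SF0 St0.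
rewrite -EFinD lee_fin -(@ler_pXn2r _ 2)// ?nnegrE ?addr_ge0 ?sqrtr_ge0//.
rewrite !lee_fin in SF0 St0.
rewrite sqr_sqrtr ?addr_ge0// sqrrD !sqr_sqrtr// addrAC [St + SF]addrC lerDl.
by rewrite mulrn_wge0// mulr_ge0 ?sqrtr_ge0.
Qed.

End LatticeEstimate.

(** * Smooth weights and cutoffs *)

Section ExistsMollifier.
Context {R : realType} {d : nat}.
Implicit Types (f : 'rV[R]_d -> R) (x y v : 'rV[R]_d).

(** The operator is chosen before [f], from the radius alone. The Taylor remainder is uniform in [x]
    because first derivatives of the average are globally Lipschitz. *)
Lemma exists_mollifier (r : R) : 0 < r ->
  exists M : ('rV[R]_d -> R) -> 'rV[R]_d -> R, forall f L, lip L f ->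
  [/\ lip L (M f) /\ smooth (M f),
      (exists B, forall x, `|f x| <= B) -> smooth_bounded (M f),
      (exists (p : 'rV[R]_d -> 'rV[R]_d) (C : R), 0 <= C /\ forall x v,
         `|M f (x + v) - M f x - eucl_dot (p x) v| <= C * `|v| ^+ 2),
      (forall x v S, (forall y, `|y - x| <= r -> f (y + v) <= f y + S) ->
         M f (x + v) <= M f x + S) &
      (forall x c, (forall y, `|y - x| <= r -> f y <= c) -> M f x <= c) /\
      (forall x c, (forall y, `|y - x| <= r -> c <= f y) -> c <= M f x)].
Proof.
move=> r0; have d1 : 0 < (d.+1%:R : R) by rewrite ltr0n.
(* The [d] averages displace the argument by at most [d * eta <= r] in total; [d.+1] keeps the
   denominator positive. *)
have eta0 : 0 < r / d.+1%:R by rewrite divr_gt0.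
set eta := r / d.+1%:R in eta0.
have [k [kT k0 k1]] := exists_kernel_tower eta eta0.
have sz : (size (enum 'I_d))%:R * eta <= r.
  by rewrite size_enum_ord /eta mulrCA ler_piMr ?(ltW r0)// ler_pdivrMr// mul1r ler_nat.
have ball (P : 'rV[R]_d -> Prop) x : (forall y, `|y - x| <= r -> P y) ->
    forall y, `|y - x| <= (size (enum 'I_d))%:R * eta -> P y.
  by move=> h y yx; apply: h; exact: le_trans yx sz.
exists (mollify eta k (enum 'I_d)) => f L fL.
have Mlip := mollify_lip eta k kT k0 k1 (enum 'I_d) f L fL.
have Mall (s : seq 'I_d) : (exists L, lip L (pderivs s (mollify eta k (enum 'I_d) f))) /\
    forall i x, derivable (pderivs s (mollify eta k (enum 'I_d) f)) x (delta_mx 0 i).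
  have [|h1 h2] := lip_pderivs_mollify eta k eta0 kT (enum 'I_d) f L fL s.
    by apply/allP => i _; rewrite /= mem_enum.
  by split=> // i x; apply: h2; rewrite /= mem_enum.
have Msmooth : smooth (mollify eta k (enum 'I_d) f).
  move=> s; have [[L' sL] sd] := Mall s; split=> //.
  exact: lip_continuous sL.
split.
- by [].
- move=> [B fB]; split=> // -[|i s].
    exists B => x; rewrite ler_norml; apply/andP; split.
      apply: (mollify_ge eta k eta0 kT k0 k1 _ _ L) => // y _.
      by have := fB y; rewrite ler_norml => /andP[].
    apply: (mollify_le eta k eta0 kT k0 k1 _ _ L) => // y _.
    by have := fB y; rewrite ler_norml => /andP[].
  (* A derivative of positive order is bounded because the one below it is Lipschitz. *)
  have [[L' sL] sd] := Mall s; exists (L' * `|delta_mx 0 i : 'rV[R]_d|) => x.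
  by apply: (derive_le_lip _ _ _ _ _ sL); exact/derivableP/sd.
- have /choice [Ls HLs] : forall j : 'I_d,
      exists L, lip L (pderivs [:: j] (mollify eta k (enum 'I_d) f)).
    by move=> j; have [] := Mall [:: j].
  exists (fun x => \row_j pderivs [:: j] (mollify eta k (enum 'I_d) f) x).
  exists (d%:R * (2 * \sum_j `|Ls j|)).
  have S0 : 0 <= \sum_j `|Ls j| by apply: sumr_ge0.
  split=> [|x v]; first by rewrite !mulr_ge0.
  have -> : eucl_dot (\row_j pderivs [:: j] (mollify eta k (enum 'I_d) f) x) v =
      \sum_j pderivs [:: j] (mollify eta k (enum 'I_d) f) x * v 0 j.
    by apply: eq_bigr => j _; rewrite mxE.
  apply: (sqr_remainder _ (fun j => pderivs [:: j] (mollify eta k (enum 'I_d) f))) => // [j y|j].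
    by have [_ /(_ j y) /derivableP] := Mall [::].
  apply: lip_ge (HLs j); apply: le_trans (ler_norm _) _.
  by rewrite (bigD1 j)//= lerDl sumr_ge0.
- move=> x v S h; apply: (le_mollify eta k eta0 kT k0 k1 _ _ _ L L) => //.
  exact: ball h.
- split=> x c h.
    by apply: (mollify_le eta k eta0 kT k0 k1 _ _ L) => //; exact: ball h.
  by apply: (mollify_ge eta k eta0 kT k0 k1 _ _ L) => //; exact: ball h.
Qed.

Lemma smooth_bounded_lip f : smooth_bounded f ->
  exists2 L, 0 <= L & lip L f.
Proof.
move=> [fs fb].
have /choice [Bs HBs] : forall j : 'I_d, exists B, forall x, `|pderivs [:: j] f x| <= B.
  by move=> j; exact: fb.
have S0 : 0 <= \sum_j `|Bs j| by apply: sumr_ge0.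
exists (d%:R * \sum_j `|Bs j|); first by rewrite mulr_ge0.
apply: (lip_of_partials f (fun j => pderivs [:: j] f)) => [j x|j x].
  by have [_ /(_ j x) /derivableP] := fs [::].
apply: le_trans (HBs j x) _; apply: le_trans (ler_norm _) _.
by rewrite (bigD1 j)//= lerDl sumr_ge0.
Qed.

End ExistsMollifier.

(** * Euclidean norm and distance compared with the sup norm *)

Section EuclideanDistance.
Context {R : realType} {d : nat}.
Implicit Types (x y v w : 'rV[R]_d) (A : set 'rV[R]_d).

Lemma eucl_dot_ge0 v : 0 <= eucl_dot v v.
Proof. by apply: sumr_ge0 => j _; rewrite -expr2 sqr_ge0. Qed.

Lemma eucl_norm_ge0 v : 0 <= eucl_norm v. Proof. exact: sqrtr_ge0. Qed.

Lemma sqr_eucl_norm v : eucl_norm v ^+ 2 = eucl_dot v v.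
Proof. by rewrite sqr_sqrtr ?eucl_dot_ge0. Qed.

(** Cauchy-Schwarz, from the nonnegative square of [|w| v - |v| w]. *)
Lemma eucl_dot_le v w : eucl_dot v w <= eucl_norm v * eucl_norm w.
Proof.
have := eucl_dot_ge0 (eucl_norm w *: v - eucl_norm v *: w).
rewrite eucl_dotDl !eucl_dotDr !eucl_dotNl !eucl_dotNr !eucl_dotZl !eucl_dotZr.
rewrite (eucl_dotC w v) -!sqr_eucl_norm.
have [v0 w0] := (eucl_norm_ge0 v, eucl_norm_ge0 w).
have [vz|vn] := eqVneq (eucl_norm v) 0.
  move=> _; rewrite vz mul0r /eucl_dot big1// => j _.
  have : eucl_dot v v = 0 by rewrite -sqr_eucl_norm vz expr0n.
  move/eqP; rewrite psumr_eq0 => [/allP /(_ j (mem_index_enum j))|i _].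
    by rewrite /= -expr2 sqrf_eq0 => /eqP ->; rewrite mul0r.
  by rewrite -expr2 sqr_ge0.
have [wz|wn] := eqVneq (eucl_norm w) 0.
  move=> _; rewrite wz mulr0 /eucl_dot big1// => j _.
  have : eucl_dot w w = 0 by rewrite -sqr_eucl_norm wz expr0n.
  move/eqP; rewrite psumr_eq0 => [/allP /(_ j (mem_index_enum j))|i _].
    by rewrite /= -expr2 sqrf_eq0 => /eqP ->; rewrite mulr0.
  by rewrite -expr2 sqr_ge0.
have p0 : 0 < eucl_norm v * eucl_norm w by rewrite mulr_gt0// lt0r ?vn ?wn.
move: (eucl_norm v) (eucl_norm w) (eucl_dot v w) p0 => a b D p0 H.
have {}H : 0 <= 2 * (a * b) * (a * b - D) by move: H; rewrite !expr2; nra.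
by rewrite -subr_ge0; move: H; rewrite pmulr_rge0// mulr_gt0.
Qed.

Lemma eucl_normD v w : eucl_norm (v + w) <= eucl_norm v + eucl_norm w.
Proof.
rewrite -(@ler_pXn2r _ 2)// ?nnegrE ?addr_ge0 ?eucl_norm_ge0//.
rewrite sqr_eucl_norm eucl_dotDl !eucl_dotDr (eucl_dotC w v) sqrrD !sqr_eucl_norm.
have := eucl_dot_le v w; rewrite mulr2n; lra.
Qed.

Lemma norm_le_eucl_norm v : `|v| <= eucl_norm v.
Proof.
rewrite rV_norm_le ?eucl_norm_ge0//; apply/forallP => j.
rewrite -sqrtr_sqr ler_wsqrtr// /eucl_dot (bigD1 j)//= -expr2 lerDl.
by apply: sumr_ge0 => i _; rewrite -expr2 sqr_ge0.
Qed.

Lemma eucl_norm_le v : eucl_norm v <= d%:R * `|v|.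
Proof.
rewrite -(@ler_pXn2r _ 2)// ?nnegrE ?mulr_ge0 ?eucl_norm_ge0//.
rewrite sqr_eucl_norm; apply: le_trans (_ : \sum_(j < d) `|v| ^+ 2 <= _).
  apply: ler_sum => j _; rewrite -expr2 -real_normK ?num_real//.
  by rewrite ler_pXn2r ?nnegrE// coord_le_norm.
rewrite sumr_const card_ord -[_ *+ d]mulr_natl exprMn ler_wpM2r ?sqr_ge0//.
by rewrite -natrX ler_nat; case: (d) => // m; rewrite expnS leq_pmulr// expn1.
Qed.

Let dists_has_inf x A : A !=set0 -> has_inf [set eucl_norm (x - y) | y in A].
Proof.
move=> [y Ay]; split; first by exists (eucl_norm (x - y)), y.
by exists 0 => _ [z _ <-]; exact: eucl_norm_ge0.
Qed.

Lemma eucl_dist_ge0 x A : A !=set0 -> 0 <= eucl_dist x A.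
Proof.
move=> A0; apply: lb_le_inf; first exact: (dists_has_inf x A A0).1.
by move=> _ [y _ <-]; exact: eucl_norm_ge0.
Qed.

Lemma eucl_dist_lip A : A !=set0 -> lip d%:R (fun x => eucl_dist x A).
Proof.
move=> A0.
have step x y : eucl_dist x A <= eucl_dist y A + d%:R * `|x - y|.
  apply/ler_addgt0Pr => e e0.
  have [_ [z Az <-] hz] := inf_adherent e0 (dists_has_inf y A A0).
  rewrite -/(eucl_dist y A) in hz.
  have h1 : eucl_dist x A <= eucl_norm (x - z).
    by apply: ge_inf; [exact: (dists_has_inf x A A0).2|exists z].
  have h2 := eucl_normD (x - y) (y - z); rewrite addrA subrK in h2.
  have h3 := eucl_norm_le (x - y); lra.
move=> x y; have h1 := step x y; have h2 := step y x; rewrite distrC in h2.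
by rewrite ler_norml; apply/andP; split; lra.
Qed.

Lemma le_mul_eucl_dist (c K : R) x A : A !=set0 -> 0 <= K ->
  (forall y, A y -> c <= K * eucl_norm (x - y)) -> c <= K * eucl_dist x A.
Proof.
move=> A0 K0 h; apply/ler_addgt0Pr => e e0.
have K1 : 0 < K + 1 by rewrite ltr_wpDl.
have [_ [y Ay <-] hy] := inf_adherent (divr_gt0 e0 K1) (dists_has_inf x A A0).
rewrite -/(eucl_dist x A) in hy; apply: le_trans (h y Ay) _.
apply: le_trans (ler_wpM2l K0 (ltW hy)) _; rewrite mulrDr lerD2l.
by rewrite mulrCA ler_piMr ?(ltW e0)// ler_pdivrMr// mul1r lerDl.
Qed.

End EuclideanDistance.

(** * From one-sided increments to the energy of the gradient, and back to lattice increments *)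

Section GradientBound.
Context {R : realType} {d : nat}.
Implicit Types (x y v w p : 'rV[R]_d).

(** From [e^a <= 1 + 2 |a|] for [|a| <= 1 / 2]. The error is proportional to [cosh t], hence
    controlled by the energy itself. *)
Lemma sinh_half_sqr_perturb (s t : R) : `|s| <= 1 / 2 ->
  sinh ((t + s) / 2) ^+ 2 <= sinh (t / 2) ^+ 2 + `|s| * (2 * sinh (t / 2) ^+ 2 + 1).
Proof.
have e1 (a : R) : `|a| <= 1 / 2 -> expR a <= 1 + 2 * `|a|.
  move=> a1; have ge := expR_ge1Dx (- `|a|); rewrite expRN in ge.
  have e0 := expR_gt0 `|a|.
  have h : expR `|a| * (1 - `|a|) <= 1.
    by rewrite -ler_pdivlMl//; rewrite mulr1.
  apply: le_trans (_ : expR `|a| <= _); first by rewrite ler_expR ler_norm.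
  have a0 := normr_ge0 a; move: (expR `|a|) (`|a|) e0 h a1 a0 => e b e0 h b1 b0; nra.
move=> s1; have h1 := e1 s s1; have h2 := e1 (- s); rewrite normrN in h2.
have {}h2 := h2 s1; rewrite !sinh_half_sqr opprD !expRD.
have t1 := expR_gt0 t; have t2 := expR_gt0 (- t); have s0 := normr_ge0 s.
move: (expR t) (expR (- t)) (expR s) (expR (- s)) `|s| t1 t2 h1 h2 s0 {s1} => a b e f n *.
nra.
Qed.

(** The step [t] is taken so small that the quadratic remainder, divided by [t], is below [e]. *)
Lemma directional_bound (f : 'rV[R]_d -> R) x p w (C sigma r : R) : 0 <= C -> 0 < r ->
  (forall v, `|f (x + v) - f x - eucl_dot p v| <= C * `|v| ^+ 2) ->
  (forall t, 0 < t -> `|t *: w| <= r -> f (x + t *: w) <= f x + t * sigma) ->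
  eucl_dot p w <= sigma.
Proof.
move=> C0 r0 fC fs; apply/ler_addgt0Pr => e e0.
have w1 : 0 < `|w| + 1 by rewrite ltr_wpDl.
have D1 : 0 < C * `|w| ^+ 2 + 1 by rewrite ltr_wpDl// mulr_ge0.
pose t := Num.min (r / (`|w| + 1)) (e / (C * `|w| ^+ 2 + 1)).
have t0 : 0 < t by rewrite lt_min !divr_gt0.
have tw : `|t *: w| <= r.
  rewrite normrZ gtr0_norm//; apply: le_trans (_ : r / (`|w| + 1) * (`|w| + 1) <= _).
    by rewrite ler_pM ?(ltW t0)// ?lerDl// ge_min lexx.
  by rewrite divfK// gt_eqF.
have te : C * `|w| ^+ 2 * t <= e.
  apply: le_trans (_ : (C * `|w| ^+ 2 + 1) * (e / (C * `|w| ^+ 2 + 1)) <= _).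
    by rewrite ler_pM ?(ltW t0) ?mulr_ge0// ?lerDl// ge_min lexx orbT.
  by rewrite mulrC divfK// gt_eqF.
have h1 := fs t t0 tw.
have := fC (t *: w); rewrite eucl_dotZr normrZ (gtr0_norm t0) ler_norml => /andP[h2 _].
have h3 : t * eucl_dot p w <= t * (sigma + e).
  have := ler_wpM2l (ltW t0) te; move: h2; rewrite exprMn !expr2.
  move: (eucl_dot p w) (`|w| * `|w|) (f (x + t *: w)) (f x) h1 => D W a b h1 h2 h3.
  rewrite mulrDr; lra.
by rewrite ler_pM2l in h3.
Qed.

(** The increment along [+e_j] or [-e_j], divided by [h], differs from plus or minus [p_j] by at
    most [C h]. Two directions per axis turn the factor 2 into 4. *)
Lemma sum_increments_le (f : 'rV[R]_d -> R) x p (C h : R) : 0 <= C -> 0 < h -> C * h <= 1 / 2 ->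
  (forall v, `|f (x + v) - f x - eucl_dot p v| <= C * `|v| ^+ 2) ->
  \sum_(i : 'I_d * bool) 2 * sinh ((f (x + h *: unit_dir i) - f x) / h / 2) ^+ 2 <=
  4 * sinh_energy p + C * h * (8 * sinh_energy p + 4 * d%:R).
Proof.
move=> C0 h0 Ch fC; have hn0 : h != 0 by rewrite gt_eqF.
have dotE (i : 'I_d * bool) : eucl_dot p (unit_dir i) = if i.2 then p 0 i.1 else - p 0 i.1.
  rewrite eucl_dotZr /eucl_dot (bigD1 i.1)//= big1 ?addr0 => [|k ki].
    by rewrite mxE !eqxx mulr1; case: i.2; rewrite ?mul1r ?mulN1r.
  by rewrite mxE (negbTE ki) andbF mulr0.
have bound (i : 'I_d * bool) : 2 * sinh ((f (x + h *: unit_dir i) - f x) / h / 2) ^+ 2 <=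
    2 * (sinh (p 0 i.1 / 2) ^+ 2 + C * h * (2 * sinh (p 0 i.1 / 2) ^+ 2 + 1)).
  rewrite ler_wpM2l//; set T := (_ - _) / h; pose q := eucl_dot p (unit_dir i).
  have qE : sinh (q / 2) ^+ 2 = sinh (p 0 i.1 / 2) ^+ 2.
    by rewrite /q dotE; case: i.2 => //; rewrite !sinh_half_sqr opprK [expR (- _) + _]addrC.
  have Tq : `|T - q| <= C * h.
    have := fC (h *: unit_dir i); rewrite eucl_dotZr -/q normrZ (gtr0_norm h0) => H.
    have -> : T - q = (f (x + h *: unit_dir i) - f x - h * q) / h by rewrite /T; field.
    rewrite normrM normfV (gtr0_norm h0) ler_pdivrMr//; apply: le_trans H _.
    rewrite -mulrA -expr2 ler_wpM2l// exprMn ler_piMr ?sqr_ge0//.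
    by rewrite expr_le1// unit_dir_norm.
  rewrite -qE; have -> : T = q + (T - q) by rewrite addrC subrK.
  apply: le_trans (sinh_half_sqr_perturb _ _ (le_trans Tq Ch)) _.
  by rewrite lerD2l ler_wpM2r// addr_ge0// mulr_ge0// sqr_ge0.
apply: (@le_trans _ _ (\sum_(i : 'I_d * bool)
    2 * (sinh (p 0 i.1 / 2) ^+ 2 + C * h * (2 * sinh (p 0 i.1 / 2) ^+ 2 + 1)))).
  by apply: ler_sum => i _; exact: bound.
rewrite -(pair_big xpredT xpredT (fun (j : 'I_d) (b : bool) =>
  2 * (sinh (p 0 j / 2) ^+ 2 + C * h * (2 * sinh (p 0 j / 2) ^+ 2 + 1)))) /=.
rewrite le_eqVlt; apply/orP; left; apply/eqP.
under eq_bigr do rewrite sumr_const card_bool.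
have -> : d%:R = \sum_(j < d) (1 : R) by rewrite sumr_const card_ord.
rewrite /sinh_energy !mulr_sumr -big_split /= mulr_sumr -big_split /=.
by apply: eq_bigr => j _; ring.
Qed.

End GradientBound.

(** * The lowered distance and the gradient of its average *)

Section AgmonWeight.
Context {R : realType} {d : nat}.
Variables (V : 'rV[R]_d -> R) (E LV MV eps : R).
Hypotheses (V_lip : lip LV V) (LV_ge0 : 0 <= LV) (V_bound : forall x, `|V x| <= MV).
Hypotheses (G_neq0 : classical_region V E !=set0) (eps01 : 0 < eps < 1).
Local Notation dE := (agmon_dist_region V E).
Local Notation K := (@finsler_const R d E MV).

(* Lowering [(1 - eps) d_E] by [eps / 2] makes the weight vanish near the
   classically allowed region. *)
Definition agmon_weight (x : 'rV[R]_d) : R := Num.max ((1 - eps) * dE x - eps / 2) 0.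

Lemma agmon_weight_step x v (S r : R) : 0 < r -> 0 <= S ->
  (forall y, `|y - x| <= `|v| + r -> agmon_finsler V E y v <= S) ->
  agmon_weight (x + v) <= agmon_weight x + (1 - eps) * S.
Proof.
move=> r0 S0 hS; have /andP[e0 e1] := eps01.
have := dist_region_step V E LV MV V_lip V_bound LV_ge0 G_neq0 x v S r r0 hS.
move=> /(ler_wpM2l (_ : 0 <= 1 - eps)) h; have {}h := h ltac:(lra).
have S1 : 0 <= (1 - eps) * S by rewrite mulr_ge0//; lra.
rewrite mulrDr in h; rewrite /agmon_weight.
by case: (leP ((1 - eps) * dE x - eps / 2) 0) => ?;
  case: (leP ((1 - eps) * dE (x + v) - eps / 2) 0) => ?; lra.
Qed.

Lemma agmon_weight_lip : lip K agmon_weight.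
Proof.
move=> x y; have /andP[e0 e1] := eps01.
have := dist_region_lip V E LV MV V_lip V_bound LV_ge0 G_neq0 x y.
have := @finsler_const_ge0 R d E MV; set D := K * _ => K0 h.
have D0 : 0 <= D by rewrite mulr_ge0.
have : `|(1 - eps) * dE x - (1 - eps) * dE y| <= D.
  rewrite -mulrBr normrM gtr0_norm; last lra.
  by apply: le_trans h; rewrite ler_piMl//; lra.
rewrite !ler_norml => /andP[h1 h2]; rewrite /agmon_weight.
by case: (leP ((1 - eps) * dE x - eps / 2) 0) => ?;
  case: (leP ((1 - eps) * dE y - eps / 2) 0) => ?; apply/andP; split; lra.
Qed.

(** The step inequality bounds [p] by [1 - eps] times a support function, so [p / (1 - eps)] lies in
    the body of the enlarged level. Convexity gives back the factor [1 - eps] in the energy. *)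
Lemma smoothed_weight_energy (M : ('rV[R]_d -> R) -> 'rV[R]_d -> R) (r C : R)
    (x p : 'rV[R]_d) : 0 < r -> 0 <= C ->
  (forall v S, (forall y, `|y - x| <= r -> agmon_weight (y + v) <= agmon_weight y + S) ->
     M agmon_weight (x + v) <= M agmon_weight x + S) ->
  (forall v, `|M agmon_weight (x + v) - M agmon_weight x - eucl_dot p v| <= C * `|v| ^+ 2) ->
  sinh_energy p <= (1 - eps) * (amplitude V E x + LV * (2 * r)).
Proof.
move=> r0 C0 Mstep MC; have /andP[e0 e1] := eps01.
set a := amplitude V E x + LV * (2 * r).
have a0 : 0 <= a by rewrite addr_ge0 ?amplitude_ge0// mulr_ge0// mulr_ge0// ltW.
have ne : 0 < 1 - eps by lra.
have r20 : 0 < r / 2 by rewrite divr_gt0.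
have main w : eucl_dot p w <= (1 - eps) * sinh_support a w.
  apply: (directional_bound (M agmon_weight) x p w C _ (r / 2) C0 r20 MC) => t t0 tw.
  rewrite mulrCA; apply: Mstep => y yx.
  have S0 : 0 <= t * sinh_support a w by rewrite mulr_ge0 ?sinh_support_ge0// ltW.
  apply: (agmon_weight_step _ _ _ (r / 2)) => // z zy.
  apply: le_trans (finsler_scale V E z t w) _; rewrite gtr0_norm// ler_pM2l//.
  rewrite agmon_finslerE; apply: sinh_support_mono; first exact: amplitude_ge0.
  (* [z] is within [r / 2 + r / 2] of [y], and [y] within [r] of [x]; this explains [2 * r] in the
     enlarged level. *)
  apply: le_trans (amplitude_lip V E LV V_lip LV_ge0 z x) _; rewrite lerD2l ler_wpM2l//.
  have -> : z - x = (z - y) + (y - x) by rewrite addrA subrK.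
  by apply: le_trans (ler_normD _ _) _; lra.
have qE : p = (1 - eps) *: ((1 - eps)^-1 *: p) by rewrite scalerA divff ?gt_eqF// scale1r.
rewrite qE; apply: le_trans (sinh_energy_scale _ _ _) _; first by apply/andP; split; lra.
rewrite ler_pM2l//; apply: sinh_energy_le_of_support => // w.
by rewrite eucl_dotZl ler_pdivrMl.
Qed.

End AgmonWeight.

(** * Cutoffs built from the distance to the allowed region *)

Section Cutoffs.
Context {R : realType} {d : nat}.

Definition clamp01 (t : R) : R := Num.max (Num.min t 1) 0.

Lemma clamp01_itv t : 0 <= clamp01 t <= 1.
Proof. by rewrite /clamp01 le_max lexx orbT ge_max ler01 ge_min lexx orbT. Qed.

Lemma clamp01_eq0 t : t <= 0 -> clamp01 t = 0.
Proof. by move=> t0; rewrite /clamp01 max_r// ge_min t0. Qed.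

Lemma clamp01_eq1 t : 1 <= t -> clamp01 t = 1.
Proof. by move=> t1; rewrite /clamp01 min_r// max_l// ler01. Qed.

Lemma clamp01_lip : lip 1 clamp01.
Proof.
move=> s t; rewrite mul1r /clamp01 ler_norml.
have h1 := ler_norm (s - t); have h2 := ler_norm (t - s); rewrite distrC in h2.
case: (leP s 1) => ?; case: (leP t 1) => ?;
  rewrite ?(max_l (_ : 0 <= 1)) ?ler01//;
  case: (leP s 0) => ?; case: (leP t 0) => ?; apply/andP; split; lra.
Qed.

Lemma lip_comp (f : R -> R) (g : 'rV[R]_d -> R) (L M : R) : 0 <= L ->
  lip L f -> lip M g -> lip (L * M) (f \o g).
Proof.
by move=> L0 fL gM x y; apply: le_trans (fL _ _) _; rewrite -mulrA ler_wpM2l.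
Qed.

Lemma tsupport_sub (f g : 'rV[R]_d -> R) (L a b : R) : lip L g ->
  (forall x, f x != 0 -> a <= g x <= b) -> tsupport f `<=` [set x | a <= g x <= b].
Proof.
move=> gL fg; rewrite /tsupport.
have cl : closed [set x | a <= g x <= b].
  have -> : [set x | a <= g x <= b] = g @^-1` [set t | a <= t] `&` g @^-1` [set t | t <= b].
    by apply/seteqP; split=> x /=; [move/andP|move=> ?; apply/andP].
  have cg := lip_continuous L g gL.
  apply: closedI; apply: closed_comp => [x _|]; try exact: cg.
    exact: closed_ge.
  exact: closed_le.
rewrite [X in _ `<=` X]((closure_id _).1 cl); apply: closure_subset => x; exact: fg.
Qed.

Lemma exists_cutoffs (G : set 'rV[R]_d) (delta : R) : G !=set0 -> 0 < delta ->
  exists (h1 : R) (chi chit : 'rV[R]_d -> R), 0 < h1 /\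
  [/\ smooth_bounded chi /\ (forall x, 0 <= chi x <= 1),
      smooth_bounded chit /\ (forall x, 0 <= chit x <= 1),
      tsupport (fun x => 1 - chi x) `<=` [set x | eucl_dist x G < delta],
      tsupport chit `<=` [set x | delta / 2 <= eucl_dist x G < delta] &
      (forall x, chi x != 0 -> delta / 2 <= eucl_dist x G) /\
      forall h x i, 0 < h < h1 -> chi (x + h *: unit_dir i) != chi x ->
        eucl_dist x G <= delta /\ chit (x + h *: unit_dir i) = 1].
Proof.
move=> G0 delta0; pose D x := eucl_dist x G.
have D_lip : lip d%:R D by exact: eucl_dist_lip.
have D0 x : 0 <= D x by exact: eucl_dist_ge0.
pose a := delta / 16; have aE : delta = 16 * a by rewrite /a; field.
have a0 : 0 < a by rewrite divr_gt0.
(* The distance is [d]-Lipschitz in the sup norm, so it varies by at most [a / 4] over radius [r];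
   the same [r] bounds the lattice spacing. *)
pose r := a / (4 * (d%:R + 1)).
have d1 : 0 < 4 * (d%:R + 1 : R) by rewrite mulr_gt0// ltr_wpDl.
have r0 : 0 < r by rewrite divr_gt0.
have dr s : 0 <= s -> s <= r -> d%:R * s <= a / 4.
  move=> s0 sr; apply: le_trans (_ : (d%:R + 1) * r <= _).
    by rewrite ler_pM// lerDl.
  by rewrite /r invfM mulrCA [_^-1 * _]mulrC mulVKf ?gt_eqF// ltr_wpDl.
have near_D x y : `|y - x| <= r -> D x - a / 4 <= D y <= D x + a / 4.
  move=> yx; have := le_trans (D_lip y x) (dr _ (normr_ge0 _) yx).
  by rewrite ler_distl.
have [M HM] := exists_mollifier (d := d) r r0.
(* Before smoothing, [chi] rises from 0 to 1 for [D x] between [11 a] and [12 a],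
   while [chit] is 1 between [10 a] and [13 a] and 0 outside [[9 a, 14 a]];
   smoothing blurs these thresholds by [a / 4]. *)
pose fchi := clamp01 \o (fun x => D x / a - 11).
pose fchit := clamp01 \o (fun x => 5 / 2 - `|D x / a - 23 / 2|).
have Da_lip (t : R) : lip (d%:R / a) (fun x => D x / a - t).
  move=> x y; rewrite opprB addrA subrK -mulrBl normrM (gtr0_norm (_ : 0 < a^-1)) ?invr_gt0//.
  by rewrite mulrAC ler_wpM2r ?invr_ge0 ?(ltW a0).
have fchi_lip : lip (1 * (d%:R / a)) fchi by exact: lip_comp clamp01_lip (Da_lip _).
have fchit_lip : lip (1 * (d%:R / a)) fchit.
  apply: lip_comp clamp01_lip _ => // x y; apply: le_trans (Da_lip (23 / 2) x y).
  have subE (s t : R) : 5 / 2 - s - (5 / 2 - t) = t - s by ring.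
  by rewrite subE distrC ler_dist_dist.
have [_ chi_sb _ _ [chi_le chi_ge]] := HM _ _ fchi_lip.
have [_ chit_sb _ _ [chit_le chit_ge]] := HM _ _ fchit_lip.
have chi01 x : 0 <= M fchi x <= 1.
  apply/andP; split; [apply: chi_ge|apply: chi_le] => y _;
  by have /andP[] := clamp01_itv (D y / a - 11).
have chit01 x : 0 <= M fchit x <= 1.
  apply/andP; split; [apply: chit_ge|apply: chit_le] => y _;
  by have /andP[] := clamp01_itv (5 / 2 - `|D y / a - 23 / 2|).
have le_mul (s t : R) : (s <= t / a) = (s * a <= t) by rewrite ler_pdivlMr.
have mul_le (s t : R) : (t / a <= s) = (t <= s * a) by rewrite ler_pdivrMr.
have chi_eq0 x : D x <= 43 / 4 * a -> M fchi x = 0.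
  move=> Dx; have /andP[c0 _] := chi01 x; apply/eqP; rewrite eq_le c0 andbT.
  apply: chi_le => y /(near_D x) /andP[_ Dy]; rewrite /fchi /= clamp01_eq0//.
  rewrite subr_le0 mul_le; apply: le_trans Dy _.
  by clear - Dx; lra.
have chi_eq1 x : 49 / 4 * a <= D x -> M fchi x = 1.
  move=> Dx; have /andP[_ c0] := chi01 x; apply/eqP; rewrite eq_le c0 /=.
  apply: chi_ge => y /(near_D x) /andP[Dy _]; rewrite /fchi /= clamp01_eq1//.
  rewrite lerBrDr le_mul; apply: le_trans Dy.
  by clear - Dx; lra.
have chit_eq1 x : 41 / 4 * a <= D x <= 51 / 4 * a -> M fchit x = 1.
  move=> /andP[Dl Du]; have /andP[_ c0] := chit01 x; apply/eqP; rewrite eq_le c0 /=.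
  apply: chit_ge => y /(near_D x) /andP[Dy1 Dy2]; rewrite /fchit /= clamp01_eq1//.
  have h1 : 10 <= D y / a by rewrite le_mul; clear - Dl Dy1; lra.
  have h2 : D y / a <= 13 by rewrite mul_le; clear - Du Dy2; lra.
  rewrite lerBrDl -lerBrDr ler_norml; clear - h1 h2.
  by apply/andP; split; lra.
have chit_neq0 x : M fchit x != 0 -> 35 / 4 * a <= D x <= 57 / 4 * a.
  apply: contraNT => Dx; have /andP[c0 _] := chit01 x; apply/eqP/eqP.
  rewrite eq_le c0 andbT.
  apply: chit_le => y /(near_D x) /andP[Dy1 Dy2]; rewrite /fchit /= clamp01_eq0//.
  rewrite subr_le0 ler_normr; move: Dx; rewrite negb_and -!ltNge => /orP[Dx|Dx].
    have : D y / a <= 9 by rewrite mul_le; clear - Dx Dy2; lra.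
    by move: (D y / a) => q q9; apply/orP; right; clear - q9; lra.
  have : 14 <= D y / a by rewrite le_mul; clear - Dx Dy1; lra.
  by move: (D y / a) => q q14; apply/orP; left; clear - q14; lra.
have fb (f : 'rV[R]_d -> R) : (forall x, 0 <= f x <= 1) -> exists B, forall x, `|f x| <= B.
  by move=> f01; exists 1 => x; have /andP[? ?] := f01 x; rewrite ger0_norm.
exists r, (M fchi), (M fchit); split=> //; split.
- by split=> //; apply: chi_sb; apply: fb => x; exact: clamp01_itv.
- by split=> //; apply: chit_sb; apply: fb => x; exact: clamp01_itv.
- apply: subset_trans (tsupport_sub _ D d%:R 0 (49 / 4 * a) D_lip _) _ => x /=.
    move=> chix; rewrite D0 leNgt; apply/negP => /ltW /chi_eq1 E1.
    by move: chix; rewrite E1 subrr eqxx.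
  by move=> /andP[_ Dx]; apply: le_lt_trans Dx _; rewrite aE; clear - a0; lra.
- apply: subset_trans (tsupport_sub _ D d%:R (35 / 4 * a) (57 / 4 * a) D_lip chit_neq0) _.
  move=> x /= /andP[Dl Du]; apply/andP; split.
    by apply: le_trans Dl; rewrite aE; clear - a0; lra.
  by apply: le_lt_trans Du _; rewrite aE; clear - a0; lra.
split=> [x chix|h x i /andP[h0 hr] neq].
  rewrite leNgt; apply/negP => Dx; move: chix; rewrite chi_eq0 ?eqxx//.
  by apply: le_trans (ltW Dx) _; rewrite aE; clear - a0; lra.
have : `|x + h *: unit_dir i - x| <= r.
  rewrite [x + _]addrC addrK normrZ gtr0_norm//; apply: le_trans (ltW hr).
  by rewrite ler_piMr ?unit_dir_norm// ltW.
move=> /(near_D x) /andP[Dy1 Dy2].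
(* Otherwise both endpoints of the hop lie at distance at most [43 / 4 * a], where [chi] is 0.
   Likewise above [25 / 2 * a] both see [chi = 1]. *)
have Dl : 21 / 2 * a < D x.
  rewrite ltNge; apply/negP => Dx; move: neq.
  by rewrite !chi_eq0 ?eqxx//; [clear - Dx a0|clear - Dx Dy2]; lra.
have Du : D x < 25 / 2 * a.
  rewrite ltNge; apply/negP => Dx; move: neq.
  by rewrite !chi_eq1 ?eqxx//; [clear - Dx a0|clear - Dx Dy1]; lra.
split; first by rewrite -/(D x) aE; clear - Du a0; lra.
by apply: chit_eq1; clear - Dl Du Dy1 Dy2; apply/andP; split; lra.
Qed.

End Cutoffs.

(** * The smooth weight and its spectral gap *)

Section SmoothWeight.
Context {R : realType} {d : nat}.
Variables (V : 'rV[R]_d -> R) (E LV MV eps : R).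
Hypotheses (V_lip : lip LV V) (LV_ge0 : 0 <= LV) (V_bound : forall x, `|V x| <= MV).
Hypotheses (G_neq0 : classical_region V E !=set0) (eps01 : 0 < eps < 1).
Local Notation dE := (agmon_dist_region V E).
Local Notation K := (@finsler_const R d E MV).

Lemma dist_region_le x : dE x <= K * eucl_dist x (classical_region V E).
Proof.
apply: le_mul_eucl_dist => //; first exact: finsler_const_ge0.
move=> y Gy; have := dist_region_lip V E LV MV V_lip V_bound LV_ge0 G_neq0 x y.
rewrite (dist_region_eq0 V E MV V_bound G_neq0 y Gy) subr0 => h.
apply: le_trans (ler_norm _) _; apply: le_trans h _.
by rewrite ler_wpM2l ?finsler_const_ge0// norm_le_eucl_norm.
Qed.

Lemma exists_smooth_weight (delta s : R) : 0 < delta -> 0 < s -> K * delta <= eps / 8 ->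
  exists (rho : 'rV[R]_d -> R) (p : 'rV[R]_d -> 'rV[R]_d) (C : R), 0 <= C /\
  [/\ [/\ smooth rho, lip K rho & forall x, 0 <= rho x],
      forall x, `|rho x - (1 - eps) * dE x| <= eps,
      forall x, eucl_dist x (classical_region V E) <= delta -> rho x = 0,
      forall x, sinh_energy (p x) <= (1 - eps) * (amplitude V E x + s) &
      forall x v, `|rho (x + v) - rho x - eucl_dot (p x) v| <= C * `|v| ^+ 2].
Proof.
move=> delta0 s0 Kd; have /andP[e0 e1] := eps01.
have ne : 0 < 1 - eps by rewrite subr_gt0.
have K0 : 0 <= K by exact: finsler_const_ge0.
have K1 : 0 < 4 * (K + 1) by rewrite mulr_gt0// ltr_wpDl.
have LV1 : 0 < 2 * (LV + 1) by rewrite mulr_gt0// ltr_wpDl.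
(* The first bound makes averaging cost at most [eps / 4], which with the shift [eps / 2] stays
   below [eps]; near the allowed region [eps / 8 + eps / 4 < eps / 2] forces [rho = 0]. The second
   bound yields [LV * (2 * r) <= s]. *)
pose r := Num.min (eps / (4 * (K + 1))) (s / (2 * (LV + 1))).
have r0 : 0 < r by rewrite lt_min !divr_gt0.
have Kr : K * r <= eps / 4.
  apply: le_trans (_ : (K + 1) * (eps / (4 * (K + 1))) <= _).
    by rewrite ler_pM ?(ltW r0)// ?lerDl// ge_min lexx.
  by rewrite invfM mulrCA [_^-1 * _]mulrC mulVKf ?gt_eqF// ltr_wpDl.
have LVr : LV * (2 * r) <= s.
  apply: le_trans (_ : (LV + 1) * (2 * (s / (2 * (LV + 1)))) <= _).
    by rewrite ler_pM ?mulr_ge0 ?(ltW r0)// ?lerDl// ler_pM2l// ge_min lexx orbT.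
  by rewrite le_eqVlt; apply/orP; left; apply/eqP; field; rewrite gt_eqF// ltr_wpDl.
have [M HM] := exists_mollifier (d := d) r r0.
have f_lip := agmon_weight_lip V E LV MV eps V_lip LV_ge0 V_bound G_neq0 eps01.
have [[rho_lip rho_s] _ [p [C [C0 rho_p]]] rho_step [rho_le rho_ge]] := HM _ _ f_lip.
set f := agmon_weight V E eps in f_lip rho_lip rho_s rho_p rho_step rho_le rho_ge.
have dE0 x : 0 <= dE x by exact: dist_region_ge0.
have rho_ge0 x : 0 <= M f x.
  by apply: rho_ge => y _; rewrite /f /agmon_weight le_max lexx orbT.
have close x y : `|y - x| <= r -> (1 - eps) * `|dE y - dE x| <= eps / 4.
  move=> yx; apply: le_trans (_ : `|dE y - dE x| <= _).
    by rewrite ler_piMl// gerBl ltW.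
  apply: le_trans (dist_region_lip V E LV MV V_lip V_bound LV_ge0 G_neq0 y x) _.
  by apply: le_trans Kr; rewrite ler_wpM2l.
have close2 x y : `|y - x| <= r ->
    (1 - eps) * dE x - eps / 4 <= (1 - eps) * dE y <= (1 - eps) * dE x + eps / 4.
  by move=> /close; rewrite -{1}(gtr0_norm ne) -normrM mulrBr ler_distl.
exists (M f), p, C; split=> //; split=> //.
- move=> x; rewrite ler_distl; apply/andP; split.
    apply: rho_ge => y /(close2 x) /andP[h1 h2].
    by rewrite /f /agmon_weight le_max; apply/orP; left; lra.
  apply: rho_le => y /(close2 x) /andP[h1 h2].
  have := mulr_ge0 (ltW ne) (dE0 x); rewrite /f /agmon_weight ge_max => h3.
  by apply/andP; split; lra.
- move=> x Dx; apply/eqP; rewrite eq_le rho_ge0 andbT.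
  apply: rho_le => y /(close2 x) /andP[_ h2]; rewrite /f /agmon_weight max_r// subr_le0.
  apply: le_trans h2 _; rewrite -lerBrDr.
  apply: le_trans (_ : dE x <= _); first by rewrite ler_piMl// gerBl ltW.
  apply: le_trans (dist_region_le x) _.
  by apply: le_trans (ler_wpM2l K0 Dx) _; lra.
- move=> x; apply: le_trans (smoothed_weight_energy V E LV MV eps V_lip LV_ge0 V_bound
    G_neq0 eps01 M r C x (p x) r0 C0 (rho_step x) (rho_p x)) _.
  by rewrite ler_pM2l// lerD2l.
Qed.

(** Four times the energy uses up [(1 - eps) (V - E)] plus at most [4 s <= eps c1 / 2]. The terms of
    order [h] take [eps c1 / 4], so [eps c1 / 4] is left. *)
Lemma gap_bound (rho : 'rV[R]_d -> R) (x p : 'rV[R]_d) (c1 s C C0 h zr : R) :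
  0 <= C -> 0 < h -> C * h <= 1 / 2 -> 0 <= s -> 8 * s <= eps * c1 ->
  (C0 + C * (8 * (MV + `|E| + s) + 4 * d%:R)) * h <= eps * c1 / 4 ->
  zr <= E + C0 * h -> 0 < c1 -> E + c1 <= V x ->
  sinh_energy p <= (1 - eps) * (amplitude V E x + s) ->
  (forall v, `|rho (x + v) - rho x - eucl_dot p v| <= C * `|v| ^+ 2) ->
  eps * c1 / 4 + \sum_(i : 'I_d * bool)
    2 * sinh ((rho (x + h *: unit_dir i) - rho x) / h / 2) ^+ 2 <= V x - zr.
Proof.
move=> C_ge0 h0 Ch s0 s8 Qh zrE c10 VE; have /andP[e0 e1] := eps01.
have VE0 : 0 <= V x - E by rewrite subr_ge0; apply: le_trans VE; rewrite lerDl ltW.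
have -> : amplitude V E x = (V x - E) / 4 by rewrite /amplitude max_l.
move=> en rp; have inc := sum_increments_le rho x p C h C_ge0 h0 Ch rp.
have en1 : sinh_energy p <= (V x - E) / 4 + s.
  by apply: le_trans en _; rewrite ler_piMl ?gerBl ?(ltW e0)// addr_ge0// divr_ge0.
have enA : sinh_energy p <= MV + `|E| + s.
  apply: le_trans en1 _; rewrite lerD2r.
  apply: le_trans (_ : V x - E <= _); first by lra.
  apply: lerD; first exact: le_trans (ler_norm _) (V_bound x).
  by rewrite -normrN ler_norm.
have i2 : C * h * (8 * sinh_energy p + 4 * d%:R) <=
    C * h * (8 * (MV + `|E| + s) + 4 * d%:R).
  by rewrite ler_wpM2l ?mulr_ge0 ?(ltW h0)// lerD2r ler_pM2l.
have Vbig : eps * c1 <= eps * (V x - E) by rewrite ler_pM2l// lerBrDl.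
have s4 : (1 - eps) * s <= s by rewrite ler_piMl// gerBl ltW.
move: (\sum_i _) inc => S inc.
move: (sinh_energy p) (MV + `|E| + s) en en1 enA i2 inc Qh => F A en en1 enA i2 inc Qh.
lra.
Qed.

End SmoothWeight.

Local Open Scope complex_scope.

Theorem theorem1 (R : realType) (d : nat) (hd : (0 < d)%N)
    (V : 'rV[R]_d -> R) (E : R)
    (hV : smooth_bounded V)
    (hG : classical_region V E !=set0)
    (hE : forall delta : R, 0 < delta ->
       (E%:E < ereal_inf [set (V x)%:E | x in ~` classical_nbhd V E delta])%E) :
  forall C0 delta0 eps : R, 0 < C0 -> 0 < delta0 -> 0 < eps < 1 ->
  exists (C h0 delta : R) (chi chit rho : 'rV[R]_d -> R),
    0 < C /\ 0 < h0 /\ 0 < delta < delta0 /\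
    (smooth_bounded chi /\ forall x, 0 <= chi x <= 1) /\
    (smooth_bounded chit /\ forall x, 0 <= chit x <= 1) /\
    tsupport (fun x => 1 - chi x) `<=` classical_nbhd V E delta /\
    tsupport chit `<=`
      classical_nbhd V E delta `\` classical_nbhd V E (delta / 2) /\
    (smooth rho /\ forall x, 0 <= rho x) /\
    (forall x, `|rho x - (1 - eps) * agmon_dist_region V E x| <= eps) /\
    forall h : R, 0 < h < h0 ->
    forall u : lattice d h -> R[i], ell2 u ->
    forall z : R[i],
      E - C0 <= complex.Re z <= E + C0 * h ->
      - C0 <= complex.Im z <= C0 ->
      (l2norm (fmul (fun x => chi x * expR (rho x / h))%R u) <=
         C%:E * l2norm (fmul chit u) +
         C%:E * l2norm (fmul (fun x => chi x * expR (rho x / h))%R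
                              (fun x => schrodinger V u x - z * u x)%R))%E.
Proof.
move=> C0 delta0 eps C00 delta00 eps01; have /andP[e0 e1] := eps01.
have [LV LV0 V_lip] := smooth_bounded_lip V hV.
have [_ /(_ [::]) [MV /= V_bound]] := hV.
pose K := @finsler_const R d E MV.
have K1 : 0 < K + 1 by rewrite ltr_wpDl ?finsler_const_ge0.
(* The second bound keeps [d_E] below [eps / 8] on the neighbourhood where the cutoffs vary. *)
pose delta := Num.min (delta0 / 2) (eps / (8 * (K + 1))).
have delta_gt0 : 0 < delta by rewrite lt_min !divr_gt0// mulr_gt0.
have delta_lt : delta < delta0.
  apply: le_lt_trans (_ : delta0 / 2 < _); first by rewrite ge_min lexx.
  by rewrite ltr_pdivrMr// ltr_pMr ?ltr1n.
have Kdelta : K * delta <= eps / 8.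
  apply: le_trans (_ : (K + 1) * (eps / (8 * (K + 1))) <= _).
    by rewrite ler_pM ?finsler_const_ge0 ?(ltW delta_gt0)// ?lerDl// ge_min lexx orbT.
  by rewrite invfM mulrCA [_^-1 * _]mulrC mulVKf ?gt_eqF.
have [c1 c10 hc1] : exists2 c1, 0 < c1 &
    forall x, delta / 2 <= eucl_dist x (classical_region V E) -> E + c1 <= V x.
  have d20 : 0 < delta / 2 by rewrite divr_gt0.
  have := hE _ d20; set I := ereal_inf _ => EI.
  (* The infimum is [+oo] if the complement is empty, so a real number above [E] and below it is
     chosen. *)
  have [m [Em mI]] : exists m : R, E < m /\ (m%:E <= I)%E.
    case: (I) EI => [m| |].
    - by rewrite lte_fin => Em; exists m.
    - by move=> _; exists (E + 1); rewrite ltrDl ltr01 leey.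
    - by rewrite ltNge leNye.
  exists (m - E) => [|x xd]; first by rewrite subr_gt0.
  rewrite addrC subrK -lee_fin; apply: le_trans mI _; apply: ereal_inf_lbound.
  by exists x => //; rewrite /classical_nbhd /= => /(le_lt_trans xd); rewrite ltxx.
have ec1 : 0 < eps * c1 by rewrite mulr_gt0.
pose s := eps * c1 / 8.
have s_gt0 : 0 < s by rewrite divr_gt0.
have [rho [p [C [C_ge0 [[rho_s rho_lip rho_ge0] rho_close rho_eq0 rho_en rho_p]]]]] :=
  exists_smooth_weight V E LV MV eps V_lip LV0 V_bound hG eps01 delta s delta_gt0 s_gt0 Kdelta.
have [h1 [chi [chit [h10 [[chi_s chi01] [chit_s chit01] supp_chi supp_chit [chi_D trans]]]]]] :=
  exists_cutoffs (classical_region V E) delta hG delta_gt0.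
pose Q := C0 + C * (8 * (MV + `|E| + s) + 4 * d%:R).
have Q0 : 0 <= Q.
  rewrite addr_ge0 ?(ltW C00)// mulr_ge0// addr_ge0// mulr_ge0// addr_ge0 ?(ltW s_gt0)//.
  by rewrite addr_ge0//; exact: le_trans (V_bound 0).
have Q1 : 0 < Q + 1 by rewrite ltr_wpDl.
have C1 : 0 < C + 1 by rewrite ltr_wpDl.
(* The bounds serve, in order, the cutoffs, the perturbation condition [C * h <= 1 / 2], and the
   absorption of all terms of order [h], including the window [C0 * h] for [Re z]. *)
pose h0 := Num.min h1 (Num.min (1 / 2 / (C + 1)) (eps * c1 / 4 / (Q + 1))).
have h00 : 0 < h0 by rewrite !lt_min h10 !divr_gt0.
have c_gt0 : 0 < eps * c1 / 4 by rewrite divr_gt0.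
have small (B b h : R) : 0 <= B -> 0 < h -> h <= b / (B + 1) -> B * h <= b.
  move=> B0 h_gt0; rewrite ler_pdivlMr ?ltr_wpDl// mulrDr mulr1 mulrC.
  by apply: le_trans; rewrite lerDl ltW.
exists (@lattice_const R d (eps * c1 / 4)), h0, delta, chi, chit, rho.
split; first by rewrite mulr_gt0 ?divr_gt0// ltr_pwDl.
split=> //; split; first by rewrite delta_gt0.
split=> //; split=> //; split=> //; split.
  apply: subset_trans supp_chit _ => x /= /andP[Dl Du]; split=> //.
  by apply/negP; rewrite -leNgt.
split=> //; split=> // h /andP[h_gt0]; rewrite !lt_min => /and3P[hh1 /ltW hC /ltW hQ].
move=> u u2 z /andP[_ Rez] _.
apply: (lattice_agmon_estimate h_gt0 V rho chi chit K) => //.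
- move=> x /chi_D /hc1 VE.
  apply: (gap_bound V E MV eps V_bound eps01 rho x (p x) c1 s C C0) => //.
  + exact: small hC.
  + exact: ltW.
  + by rewrite /s mulrC divfK.
  + exact: small hQ.
- move=> x i neq; have [|Dx chit1] := trans h x i _ neq; first by rewrite h_gt0.
  by rewrite rho_eq0.
- exact: finsler_const_ge0.
Qed.
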